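(* For any $\varepsilon\in(0,1)$ there exists a bounded open set $\Omega\subset\mathbf R^2$ with $C^{1,1}$-boundary such that $$\Sigma(\mathbf R^2\setminus\Omega)=\{(x,f(x))\in\mathbf R^2\mid x\in[0,1]\},$$ where $f:[0,1]\to\mathbf R$ is a DC function with the following property: there is a closed subset $C\subset[0,1]$ with Lebesgue measure $|C|\ge 1-\varepsilon$ such that for any $x\in C$ and any $\delta>0$, the restricted function $f|_{B_\delta(x)\cap[0,1]}$, where $B_\delta(x):=(x-\delta,x+\delta)$, has derivative with infinitely many upward and (infinitely many) downward jumps. In particular, $f|_{B_\delta(x)\cap[0,1]}$ is neither $C^1$, nor locally semi-concave, nor locally semi-convex.
   Context: $\mathbf R^2$ carries the standard Euclidean metric. For a closed set $N\subset\mathbf R^2$, $d_N:\mathbf R^2\setminus N\to(0,\infty)$ is the Euclidean distance $d_N(p)=\inf_{q\in N}|q-p|$, and $\Sigma(N)$ is the set of $p\in\mathbf R^2\setminus N$ at which $d_N$ is not differentiable. A DC (delta-convex) function is one that is a difference of two convex functions. An upward (resp. downward) jump of $f'$ is a point $t$ at which the one-sided limits satisfy $f'(t+0)-f'(t-0)>0$ (resp. $<0$). A function is locally semi-concave if, on each convex open set compactly contained in its domain, $u(x)-C|x|^2$ is concave for some constant $C>0$; it is locally semi-convex if $-u$ is locally semi-concave. *)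

(* Defs.v *)
From HB Require Import structures.
From mathcomp Require Import all_boot all_order all_algebra.
From mathcomp Require Import all_classical all_reals all_analysis.

Set Implicit Arguments.
Unset Strict Implicit.
Unset Printing Implicit Defensive.

Import Order.TTheory GRing.Theory Num.Theory.
Import numFieldNormedType.Exports.

Local Open Scope classical_set_scope.
Local Open Scope ring_scope.

(* The norm that the library puts on [R * R] is the sup norm: it is used below
   only through notions that do not depend on the choice of a norm on the plane
   (open and bounded sets, closure, differentiability). *)
Definition euclid_norm (R : realType) (p : R * R) : R :=
  Num.sqrt (p.1 ^+ 2 + p.2 ^+ 2).

(* Total function: it is [0] on [N] and, since [inf set0 = 0], meaningful only
   for nonempty [N]. *)
Definition euclid_dist (R : realType) (N : set (R * R)) (p : R * R) : R :=
  inf [set euclid_norm (q - p) | q in N].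

Definition Sigma (R : realType) (N : set (R * R)) : set (R * R) :=
  [set p | ~ N p /\ ~ differentiable (euclid_dist N) p].

Definition C11_on (R : realType) (I : set R) (g : R -> R) : Prop :=
  (forall s, I s -> derivable g s 1) /\
  exists k : R, k.-lipschitz_I (derive1 g).

(* Around each boundary point [p], in the orthonormal frame centred at [p] with
   axes [(a, b)] and [(- b, a)], the set [Omega] is the strict epigraph of a
   [C^{1,1}] function.  Both orientations of the second axis are covered, since
   [(a, b)] may be replaced by its opposite. *)
Definition C11_boundary (R : realType) (Omega : set (R * R)) : Prop :=
  forall p : R * R, closure Omega p -> closure (~` Omega) p ->
  exists (r a b : R) (g : R -> R),
    [/\ 0 < r, a ^+ 2 + b ^+ 2 = 1, C11_on `]- r, r[ g &
      forall q : R * R, euclid_norm (q - p) < r ->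
        (Omega q <->
         g (a * (q.1 - p.1) + b * (q.2 - p.2)) <
         a * (q.2 - p.2) - b * (q.1 - p.1))].

Definition concave_function (R : realType) (D : set R) (f : R -> R) : Prop :=
  convex_function (D : set (convex_lmodType R^o)) (fun x => - f x).

Definition DC_on (R : realType) (I : set R) (f : R -> R) : Prop :=
  exists g h : R -> R,
    [/\ convex_function (I : set (convex_lmodType R^o)) g,
        convex_function (I : set (convex_lmodType R^o)) h &
        forall x, I x -> f x = g x - h x].

(* [l] is the limit of [f'] at [t] along [F] (to be taken as [t^'-] or [t^'+]),
   where [f'] lives on the set of points at which [f] is derivable.  This set
   must accumulate at [t] along [F]; otherwise every [l] would be a limit. *)
Definition deriv_lim (R : realType) (f : R -> R) (F : set_system R) (l : R)
    : Prop :=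
  let G := within [set s | derivable f s 1] F in
  ProperFilter G /\ derive1 f @ G --> l.

Definition upward_jumps (R : realType) (I : set R) (f : R -> R) : set R :=
  [set t | I^° t /\
    exists l r : R,
      [/\ deriv_lim f t^'- l, deriv_lim f t^'+ r & 0 < r - l]].

Definition downward_jumps (R : realType) (I : set R) (f : R -> R) : set R :=
  [set t | I^° t /\
    exists l r : R,
      [/\ deriv_lim f t^'- l, deriv_lim f t^'+ r & r - l < 0]].

(* The derivative is one-sided at the end points that belong to the interval
   [I]. *)
Definition C1_on (R : realType) (I : set R) (f : R -> R) : Prop :=
  exists g : R -> R,
    (forall t, I t ->
       (f s - f t) / (s - t) @[s --> within I t^'] --> g t) /\
    {within I, continuous g}.

Definition locally_semiconcave_on (R : realType) (I : set R) (u : R -> R)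
    : Prop :=
  forall U : set R,
    open U -> convex_set (U : set (convex_lmodType R^o)) ->
    compact (closure U) -> closure U `<=` I ->
    exists2 C : R, 0 < C & concave_function U (fun x => u x - C * `|x| ^+ 2).

Definition locally_semiconvex_on (R : realType) (I : set R) (u : R -> R)
    : Prop :=
  locally_semiconcave_on I (fun x => - u x).

(* Main.v *)
From HB Require Import structures.
Require Import Defs.
From mathcomp Require Import all_boot all_order all_algebra.
From mathcomp Require Import all_classical all_reals all_analysis.
From mathcomp Require Import ring lra.

(* Let [a] enumerate a countable dense set of reals and let [sigma] be a sign
   which takes both values on dense subsets of it.  The functions
   [G x = sum_n c_n |x - a_n|] and [f x = sum_n sigma(a_n) c_n |x - a_n|]
   (up to constants) are such that [G + f] and [G - f] are convex, and [f'] jumps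
   upward or downward at [a_n] according to [sigma(a_n)]; so [C = [0, 1]] will do.
   Let [r = 1 - G], and let [Omega] be the union over [x] in [[0, 1]] of the balls
   of centre [(x, f x)] and radius [r x].  Since [r + f] and [r - f] are concave,
   [Omega] is convex and each of these balls touches the complement at two points.
   A convex open set that is a union of balls of radius at least [3 / 4] has a
   [C^{1,1}] boundary.  Finally, let [p] be in [Omega], with nearest boundary point
   [Q], and let the ball of centre [c = (x, f x)] touch at [Q].  Both [p] and [c] lie
   on the inner normal at [Q], and [p] is not beyond [c] since otherwise the ball
   around [p] would contain the other touching point of the ball around [c].  So
   [p] is either [c], where there are two nearest points, or strictly between [c]
   and [Q], where the distance is squeezed between two smooth functions. *)

Import Order.TTheory GRing.Theory Num.Theory.
Import numFieldNormedType.Exports.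

Local Open Scope classical_set_scope.
Local Open Scope ring_scope.

Set Implicit Arguments.
Unset Strict Implicit.

(** * Weighted series *)

Definition bounded_seq {R : realType} (s : nat -> R) : Prop :=
  exists B, forall n, `|s n| <= B.

(** The weights sum to [1], so a common bound on the absolute values of the terms also bounds the
    sum. If the series diverges, the value is the default of [limn]. *)
Definition wsum {R : realType} (s : nat -> R) : R :=
  limn (series (fun n => 2^-1 ^+ n.+1 * s n)).

Lemma weight_gt0 (R : realType) n : 0 < 2^-1 ^+ n :> R.
Proof. by rewrite exprn_gt0// invr_gt0 ltr0n. Qed.

Lemma tail_series_le (R : realType) (s : nat -> R) (N : nat) (B : R) (M : nat) :
  (forall n, `|s n| <= B) -> (forall n, (n < N)%N -> s n = 0) ->
  `|series (fun n => 2^-1 ^+ n.+1 * s n) M| <= B * 2^-1 ^+ N.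
Proof.
move=> sB s0; have B0 : 0 <= B by exact: le_trans (normr_ge0 _) (sB 0%N).
(* The bound [B * 2^-1 ^+ N] is not inductive in [M]; the exact geometric sum of the weights between
   [N] and [M] is. *)
suff : `|series (fun n => 2^-1 ^+ n.+1 * s n) M| <=
    (if (M <= N)%N then 0 else B * (2^-1 ^+ N - 2^-1 ^+ M)).
  case: ifP => _ /le_trans; apply.
    by rewrite mulr_ge0// ltW// weight_gt0.
  by rewrite ler_wpM2l// gerBl ltW// weight_gt0.
elim: M => [|M IH]; first by rewrite /series/= big_geq// normr0.
rewrite seriesSr /=; apply: le_trans (ler_normD _ _) _.
have [MN|NM] := ltnP M N.
  by move: IH; rewrite (ltnW MN) s0// mulr0 normr0 addr0.
rewrite [X in _ + X <= _]normrM (gtr0_norm (weight_gt0 _ _)).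
have H : 2^-1 ^+ M.+1 * `|s M| <= 2^-1 ^+ M.+1 * B.
  by rewrite ler_wpM2l// ltW// weight_gt0.
apply: le_trans (lerD IH H) _.
case: ifP => MN; last by rewrite exprS; lra.
have -> : N = M by apply/eqP; rewrite eqn_leq NM MN.
by rewrite exprS; lra.
Qed.

Lemma is_cvg_wsum (R : realType) (s : nat -> R) : bounded_seq s ->
  cvgn (series (fun n => 2^-1 ^+ n.+1 * s n)).
Proof.
move=> [B sB]; apply: normed_cvg.
apply: (@series_le_cvg R _ (fun n => 2^-1 ^+ n.+1 * B)) => [n|n|n|].
- exact: normr_ge0.
- by rewrite mulr_ge0 ?(le_trans (normr_ge0 _) (sB n))// ltW// weight_gt0.
- by rewrite /= normrM (gtr0_norm (weight_gt0 _ _)) ler_wpM2l// ltW// weight_gt0.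
- have -> : (fun n => 2^-1 ^+ n.+1 * B) = geometric (2^-1 * B) 2^-1.
    by apply/funext => n; rewrite /geometric/= exprS; ring.
  by apply: is_cvg_geometric_series; rewrite gtr0_norm; lra.
Qed.

Lemma bounded_seqD (R : realType) (s t : nat -> R) :
  bounded_seq s -> bounded_seq t -> bounded_seq (s \+ t).
Proof.
move=> [A sA] [B tB]; exists (A + B) => n.
exact: le_trans (ler_normD _ _) (lerD (sA n) (tB n)).
Qed.

Lemma bounded_seqZ (R : realType) (s : nat -> R) k :
  bounded_seq s -> bounded_seq (fun n => k * s n).
Proof.
by move=> [A sA]; exists (`|k| * A) => n; rewrite normrM ler_wpM2l.
Qed.

Lemma wsumD (R : realType) (s t : nat -> R) :
  bounded_seq s -> bounded_seq t -> wsum (fun n => s n + t n) = wsum s + wsum t.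
Proof.
move=> bs bt; rewrite /wsum -lim_seriesD; [|exact: is_cvg_wsum..].
by congr (limn (series _)); apply/funext => n /=; rewrite mulrDr.
Qed.

Lemma wsumZ (R : realType) (s : nat -> R) k :
  bounded_seq s -> wsum (fun n => k * s n) = k * wsum s.
Proof.
move=> bs; rewrite /wsum -[RHS]/(k *: _) -lim_seriesZ; last exact: is_cvg_wsum.
congr (limn (series _)); apply/funext => n /=.
by rewrite -[RHS]/(k * (_ * _)); ring.
Qed.

Lemma wsumB (R : realType) (s t : nat -> R) :
  bounded_seq s -> bounded_seq t -> wsum (fun n => s n - t n) = wsum s - wsum t.
Proof.
move=> bs bt; rewrite wsumD//; last first.
  by move: bt => [B tB]; exists B => n; rewrite normrN.
congr (_ + _); rewrite -mulN1r -wsumZ//.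
by congr wsum; apply/funext => n; rewrite mulN1r.
Qed.

Lemma ler_wsum (R : realType) (s t : nat -> R) :
  bounded_seq s -> bounded_seq t -> (forall n, s n <= t n) -> wsum s <= wsum t.
Proof.
move=> bs bt st; apply: lim_series_le; [exact: is_cvg_wsum..|].
by move=> n; rewrite ler_wpM2l// ltW// weight_gt0.
Qed.

(** This makes differentiation under the sum possible: once the first [N] terms cancel exactly, the
    rest is uniformly small. *)
Lemma wsum_tail (R : realType) (s : nat -> R) (N : nat) (B : R) :
  (forall n, `|s n| <= B) -> (forall n, (n < N)%N -> s n = 0) ->
  `|wsum s| <= B * 2^-1 ^+ N.
Proof.
move=> sB s0; have cs : bounded_seq s by exists B.
rewrite ler_norml; apply/andP; split.
- apply: limr_ge; first exact: is_cvg_wsum.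
  apply: nearW => M; have := tail_series_le M sB s0.
  by rewrite ler_norml => /andP[].
- apply: limr_le; first exact: is_cvg_wsum.
  apply: nearW => M; have := tail_series_le M sB s0.
  by rewrite ler_norml => /andP[].
Qed.

Lemma wsum_le (R : realType) (s : nat -> R) (B : R) :
  (forall n, `|s n| <= B) -> `|wsum s| <= B.
Proof. by move=> sB; have := @wsum_tail R s 0 B sB; rewrite expr0 mulr1; apply. Qed.

Lemma wsum_gt0 (R : realType) (s : nat -> R) k :
  bounded_seq s -> (forall n, 0 <= s n) -> 0 < s k -> 0 < wsum s.
Proof.
move=> bs s0 sk; apply: (@lt_le_trans _ _ (2^-1 ^+ k.+1 * s k)).
  by rewrite mulr_gt0// weight_gt0.
apply: limr_ge; first exact: is_cvg_wsum.
exists k.+1 => // M /= kM.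
rewrite /series/= (bigD1_seq k)/= ?mem_index_iota ?iota_uniq//=.
rewrite lerDl sumr_ge0// => i _.
by rewrite mulr_ge0// ltW// weight_gt0.
Qed.

(** * Corners of functions on the line *)

(** Two-point differentiability at [t] relative to [S]. Since both points move, taking for [S] a
    closed half-line ending at [t] controls the one-sided derivative at [t] and also the one-sided
    limit of the derivative there. *)
Definition strict_deriv {R : realType} (S : set R) (f : R -> R) (t L : R) : Prop :=
  forall eta, 0 < eta -> exists2 d, 0 < d &
    forall x y, S x -> S y -> `|x - t| < d -> `|y - t| < d ->
      `|f x - f y - L * (x - y)| <= eta * `|x - y|.

Lemma strict_derivN (R : realType) (S : set R) (f : R -> R) (t L : R) :
  strict_deriv S f t L -> strict_deriv S (fun x => - f x) t (- L).
Proof.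
move=> H eta /H[d d0 Hd]; exists d => // x y Sx Sy xt yt.
rewrite (_ : _ - _ = - (f x - f y - L * (x - y))); last by ring.
by rewrite normrN; exact: Hd.
Qed.

Lemma strict_deriv_cvg (R : realType) (S : set R) (f : R -> R) (t L : R) :
  S t -> strict_deriv S f t L ->
  (f s - f t) / (s - t) @[s --> within S t^'] --> L.
Proof.
move=> St H; apply/cvgrPdist_le => eta eta0.
have [d d0 Hd] := H _ eta0.
rewrite near_withinE; near=> s => Ss.
have st : s != t by near: s; exact: nbhs_dnbhs_neq.
have st0 : s - t != 0 by rewrite subr_eq0.
have std : `|s - t| < d.
  near: s; apply: nbhs_dnbhs.
  by exists d => //= z; rewrite /ball_/= distrC.
have := Hd s t Ss St std; rewrite subrr normr0 => /(_ d0) {}Hd.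
rewrite -(ler_pM2r (x := `|s - t|)) ?normr_gt0// -normrM mulrBl divfK//.
by rewrite distrC.
Unshelve. all: by end_near. Qed.

Lemma strict_deriv_derivable (R : realType) (f : R -> R) (t L : R) :
  strict_deriv setT f t L -> derivable f t 1.
Proof.
move=> H; apply/cvg_ex; exists L; apply/cvgrPdist_le => eta eta0.
have [d d0 Hd] := H _ eta0.
near=> h.
have h0 : h != 0 by near: h; exact: nbhs_dnbhs_neq.
have hd : `|h| < d.
  near: h; apply: nbhs_dnbhs.
  by exists d => //= z; rewrite /ball_/= sub0r normrN.
have := Hd (h + t) t I I; rewrite addrK subrr normr0 => /(_ hd d0) {}Hd.
rewrite /= -(ler_pM2r (x := `|h|)) ?normr_gt0// -normrM mulrBl.
rewrite /GRing.scale/= mulr1 (mulrC h^-1) divfK//.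
by rewrite distrC.
Unshelve. all: by end_near. Qed.

Lemma derive1_dist_le (R : realType) (f : R -> R) (s L d eta : R) :
  0 < d -> derivable f s 1 ->
  (forall y, `|y - s| < d -> `|f y - f s - L * (y - s)| <= eta * `|y - s|) ->
  `|L - derive1 f s| <= eta.
Proof.
move=> d0 df H; rewrite derive1E.
have cv : (fun h => h^-1 *: ((f \o shift s) (h *: 1) - f s)) @ 0^' --> 'D_1 f s.
  exact: df.
have : `|L - h^-1 *: ((f \o shift s) (h *: 1) - f s)| @[h --> 0^'] --> `|L - 'D_1 f s|.
  by apply: cvg_norm; apply: cvgB => //; exact: cvg_cst.
move=> {}cv; rewrite -(cvg_lim _ cv)//; apply: limr_le; first by apply/cvg_ex; eexists; exact: cv.
near=> h.
have h0 : h != 0 by near: h; exact: nbhs_dnbhs_neq.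
have hd : `|h| < d.
  near: h; apply: nbhs_dnbhs.
  by exists d => //= z; rewrite /ball_/= sub0r normrN.
have := H (h + s); rewrite addrK => /(_ hd) {}H.
rewrite /= -(ler_pM2r (x := `|h|)) ?normr_gt0// -normrM mulrBl.
rewrite /GRing.scale/= mulr1 (mulrC h^-1) divfK//.
by rewrite distrC.
Unshelve. all: by end_near. Qed.

Lemma strict_deriv_lim_left (R : realType) (f : R -> R) (t L : R) :
  (forall x y, x < y -> exists s, x < s < y /\ derivable f s 1) ->
  strict_deriv [set x | x <= t] f t L -> deriv_lim f t^'- L.
Proof.
move=> dns H; split.
  (* By density, points of derivability accumulate at [t] from the left. *)
  apply: Build_ProperFilter => -[e /= e0 He].
  have [s [/andP[s1 s2] ds]] := dns (t - e) t ltac:(by rewrite ltrBlDr ltrDl).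
  apply: (He s) => //=.
  by rewrite ger0_norm ?subr_ge0 ?ltW//; rewrite ltrBlDr -ltrBlDl.
apply/cvgrPdist_le => eta eta0; have [d d0 Hd] := H _ eta0.
rewrite near_withinE; near=> s => ds.
have st : s < t by near: s; exact: nbhs_left_lt.
have sd : t - d < s by near: s; apply: nbhs_left_gt; rewrite ltrBlDr ltrDl.
(* This radius around [s] keeps [y] to the left of [t] and within [d] of it, where the two-point
   estimate applies. *)
apply: (@derive1_dist_le _ _ _ _ (Num.min (t - s) (s - (t - d)))) => //.
  by rewrite lt_min !subr_gt0 st sd.
move=> y; rewrite lt_min !ltr_norml => /andP[/andP[y1 y2] /andP[y3 y4]].
by apply: Hd => /=; rewrite ?ltr_norml; lra.
Unshelve. all: by end_near. Qed.

Lemma strict_deriv_lim_right (R : realType) (f : R -> R) (t L : R) :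
  (forall x y, x < y -> exists s, x < s < y /\ derivable f s 1) ->
  strict_deriv [set x | t <= x] f t L -> deriv_lim f t^'+ L.
Proof.
move=> dns H; split.
  apply: Build_ProperFilter => -[e /= e0 He].
  have [s [/andP[s1 s2] ds]] := dns t (t + e) ltac:(by rewrite ltrDl).
  apply: (He s) => //=.
  by rewrite distrC ger0_norm ?subr_ge0 ?ltW//; rewrite ltrBlDl.
apply/cvgrPdist_le => eta eta0; have [d d0 Hd] := H _ eta0.
rewrite near_withinE; near=> s => ds.
have st : t < s by near: s; exact: nbhs_right_gt.
have sd : s < t + d by near: s; apply: nbhs_right_lt; rewrite ltrDl.
apply: (@derive1_dist_le _ _ _ _ (Num.min (s - t) (t + d - s))) => //.
  by rewrite lt_min !subr_gt0 st sd.
move=> y; rewrite lt_min !ltr_norml => /andP[/andP[y1 y2] /andP[y3 y4]].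
by apply: Hd => /=; rewrite ?ltr_norml; lra.
Unshelve. all: by end_near. Qed.

Lemma conv_realE (R : realType) (k : {i01 R}) (x y : convex_lmodType R^o) :
  conv k x y = k%:num * x + (1 - k%:num) * y.
Proof. by []. Qed.

Lemma conv_regularE (R : realType) (k : {i01 R}) (x y : R^o) :
  conv k x y = k%:num * x + (1 - k%:num) * y.
Proof. by []. Qed.

(* The corner contributes [(r - l) h] to the second difference at scale [h],
   which beats the [2 C h ^ 2] allowed by semi-concavity. *)
Lemma corner_not_semiconcave (R : realType) (I : set R) (f : R -> R) (t l r : R) :
  I° t -> strict_deriv [set x | x <= t] f t l ->
  strict_deriv [set x | t <= x] f t r -> l < r -> ~ locally_semiconcave_on I f.
Proof.
move=> [e /= e0 eI] Hl Hr lr sc.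
pose U : set R := `]t - e / 2, t + e / 2[%classic.
have cU : closure U `<=` `[t - e / 2, t + e / 2]%classic.
  rewrite [X in _ `<=` X](_ : _ = closure `[t - e / 2, t + e / 2]%classic).
    apply: closureS => x; rewrite /U/= !in_itv/= => /andP[? ?]; lra.
  by apply/closure_id; exact: itv_closed.
have [C C0 conc] : exists2 C : R, 0 < C &
    concave_function U (fun x => f x - C * `|x| ^+ 2).
  apply: sc.
  - exact: itv_open.
  - move=> x y k; rewrite !inE /U/= !in_itv/= => /andP[x1 x2] /andP[y1 y2].
    have k0 : 0 <= k%:num by [].
    have k1 : k%:num <= 1 by [].
    rewrite conv_realE; apply/andP; split; have [xy|/ltW xy] := leP x y; nra.
  - apply: (subclosed_compact _ (@segment_compact _ _ _) cU).
    exact: closed_closure.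
  - move=> x /cU; rewrite /= in_itv/= => /andP[x1 x2]; apply: eI => /=.
    rewrite ltr_norml. lra.
(* An error of a quarter of the jump on each side leaves at least [(r - l) / 2 * h] in the second
   difference. The bound [(r - l) / (4 * C)] on the step below makes this exceed
   [2 * C * h ^+ 2]. *)
have lr4 : 0 < (r - l) / 4 by lra.
have [d1 d10 Hd1] := Hl _ lr4; have [d2 d20 Hd2] := Hr _ lr4.
pose m := Num.min (Num.min d1 d2) (Num.min (e / 2) ((r - l) / (4 * C))).
have m0 : 0 < m by rewrite !lt_min d10 d20 !divr_gt0//; lra.
have md1 : m <= d1 by rewrite !ge_min lexx.
have md2 : m <= d2 by rewrite !ge_min lexx !orbT.
have me : m <= e / 2 by rewrite !ge_min lexx !orbT.
have mC : m <= (r - l) / (4 * C) by rewrite !ge_min lexx !orbT.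
pose h := m / 2; have h0 : 0 < h by rewrite /h; lra.
have hm : h < m by rewrite /h; lra.
have [] : [/\ `|h| = h, `|- h| = h & `|0 : R| = 0].
  by rewrite normrN gtr0_norm// normr0.
move=> nh nNh n0.
have := Hd1 (t - h) t; rewrite addrAC subrr add0r nNh n0 /= => Q1.
have := Hd2 (t + h) t; rewrite addrAC subrr add0r nh n0 /= => Q2.
have {}Q1 := Q1 ltac:(lra) (lexx _) ltac:(lra) d10.
have {}Q2 := Q2 ltac:(lra) (lexx _) ltac:(lra) d20.
have half1 : 2^-1 <= (1 : R) by lra.
have half0 : 0 <= (2^-1 : R) by lra.
have := conc (Itv01 half0 half1) (t + h) (t - h); rewrite !inE /U/= !in_itv/=.
have -> : t - e / 2 < t + h < t + e / 2 by apply/andP; split; lra.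
have -> : t - e / 2 < t - h < t + e / 2 by apply/andP; split; lra.
move=> /(_ isT isT).
rewrite conv_realE conv_regularE /= !real_normK ?num_real//.
rewrite (_ : 2^-1 * (t + h) + (1 - 2^-1) * (t - h) = t); last by lra.
move=> conc'.
have C4 : 0 < 4 * C by lra.
have hC : m * (4 * C) <= r - l by rewrite -ler_pdivlMr.
move: Q1 Q2; rewrite !ler_norml => /andP[Q1 Q1'] /andP[Q2 Q2'].
have E1 : f (t + h) + f (t - h) - 2 * f t <= 2 * C * h ^+ 2 by nra.
have E2 : (r - l) / 2 * h <= f (t + h) + f (t - h) - 2 * f t by lra.
have : (r - l) / 2 * h <= 2 * C * h * h by move: E1; rewrite expr2; lra.
rewrite ler_pM2r// /h; nra.
Qed.

(** At an interior point of [I], the limit of the difference quotient along [I] is also its limit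
    from either side, which would force [l = r]. *)
Lemma corner_not_C1 (R : realType) (I : set R) (f : R -> R) (t l r : R) :
  I° t -> strict_deriv [set x | x <= t] f t l ->
  strict_deriv [set x | t <= x] f t r -> l < r -> ~ C1_on I f.
Proof.
move=> It Hl Hr lr [g [Hg _]]; have := Hg t (interior_subset It) => {}Hg.
have nbI : nbhs t I by [].
have cl : (f s - f t) / (s - t) @[s --> t^'-] --> l.
  apply: cvg_trans (strict_deriv_cvg (lexx t) Hl).
  apply: cvg_app => A; apply: (@filterS _ (nbhs t)) => s As st.
  by apply: As; rewrite /= ?lt_eqF// ltW.
have cr : (f s - f t) / (s - t) @[s --> t^'+] --> r.
  apply: cvg_trans (strict_deriv_cvg (lexx t) Hr).
  apply: cvg_app => A; apply: (@filterS _ (nbhs t)) => s As st.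
  by apply: As; rewrite /= ?gt_eqF// ltW.
have gl : (f s - f t) / (s - t) @[s --> t^'-] --> g t.
  apply: cvg_trans Hg.
  apply: cvg_app => A; apply: (@filterS2 _ (nbhs t) _ I) => // s Is As st.
  by apply: As; rewrite /= ?lt_eqF.
have gr : (f s - f t) / (s - t) @[s --> t^'+] --> g t.
  apply: cvg_trans Hg.
  apply: cvg_app => A; apply: (@filterS2 _ (nbhs t) _ I) => // s Is As st.
  by apply: As; rewrite /= ?gt_eqF.
have E1 : l = g t by rewrite -(cvg_lim _ cl)// -(cvg_lim _ gl).
have E2 : r = g t by rewrite -(cvg_lim _ cr)// -(cvg_lim _ gr).
by move: lr; rewrite E1 E2 ltxx.
Qed.

(** * A function with densely many upward and downward corners *)

(** Subtracting [|a n|] makes each term vanish at [0] and stay below [|c n| * |x|], even though the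
    points [a n] are unbounded in the application. *)
Definition kink_sum {R : realType} (c a : nat -> R) (x : R) : R :=
  wsum (fun n => c n * (`|x - a n| - `|a n|)).

Lemma bounded_seqM (R : realType) (s t : nat -> R) :
  bounded_seq s -> bounded_seq t -> bounded_seq (fun n => s n * t n).
Proof.
move=> [A sA] [B tB]; exists (A * B) => n.
by rewrite normrM ler_pM.
Qed.

Lemma bounded_kink (R : realType) (c a : nat -> R) (x : R) :
  bounded_seq c -> bounded_seq (fun n => c n * (`|x - a n| - `|a n|)).
Proof.
move=> bc; apply: bounded_seqM => //; exists `|x| => n.
rewrite -(normrN (a n)); apply: le_trans (ler_dist_dist _ _) _.
by rewrite opprK subrK.
Qed.

Lemma common_radius (R : realType) (P : nat -> R -> Prop) (N : nat) :
  (forall n, exists2 d, 0 < d & P n d) ->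
  (forall n d d', d' <= d -> P n d -> P n d') ->
  exists2 d, 0 < d & forall n, (n < N)%N -> P n d.
Proof.
move=> H mono; elim: N => [|N [d d0 Hd]]; first by exists 1.
have [e e0 He] := H N; exists (Num.min d e); first by rewrite lt_min d0.
move=> n; rewrite ltnS leq_eqVlt => /predU1P[->|nN].
  by apply: mono He; rewrite ge_min lexx orbT.
by apply: mono (Hd n nN); rewrite ge_min lexx.
Qed.

(** Here [sg n] is the slope of the [n]-th kink on [S] near [t], on a neighbourhood that depends on
    [n]. A common neighbourhood serves the first [N] terms, whose error is then zero; each later
    term has an error of at most [2 * |x - y|], and these are damped by the weights. *)
Lemma kink_sum_strict (R : realType) (S : set R) (c a sg : nat -> R) (t : R) :
  (forall n, `|c n| <= 1) -> (forall n, `|sg n| <= 1) ->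
  (forall n, exists2 d, 0 < d & forall x y, S x -> S y ->
     `|x - t| < d -> `|y - t| < d -> `|x - a n| - `|y - a n| = sg n * (x - y)) ->
  strict_deriv S (kink_sum c a) t (wsum (fun n => c n * sg n)).
Proof.
move=> c1 sg1 H eta eta0.
have bc : bounded_seq c by exists 1.
have bs : bounded_seq sg by exists 1.
have [N Neta] : exists N, 2 * 2^-1 ^+ N <= eta :> R.
  have : 2 * 2^-1 ^+ n @[n --> \oo] --> (0 : R).
    rewrite -[X in _ --> X](mulr0 2); apply: cvgMr.
    by apply: cvg_expr; rewrite gtr0_norm; lra.
  move=> /cvgrPdist_le/(_ _ eta0)[N _ /(_ N (leqnn _))].
  rewrite /= sub0r normrN gtr0_norm ?mulr_gt0 ?weight_gt0// => HN.
  by exists N.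
have [d d0 Hd] := common_radius N H ltac:(by move=> n d d' dd' h x y Sx Sy xd yd; apply: h => //; exact: lt_le_trans dd').
exists d => // x y Sx Sy xd yd.
rewrite /kink_sum -wsumB; [|exact: bounded_kink..].
rewrite mulrC -wsumZ; last exact: bounded_seqM.
rewrite -wsumB; first last.
- by apply: bounded_seqZ; exact: bounded_seqM.
- have [A HA] := bounded_kink a x bc; have [B HB] := bounded_kink a y bc.
  by exists (A + B) => n; apply: le_trans (ler_normB _ _) _; rewrite lerD.
apply: (@le_trans _ _ ((2 * `|x - y|) * 2^-1 ^+ N)); last first.
  by rewrite mulrAC ler_wpM2r.
apply: wsum_tail => [n|n nN].
  rewrite (_ : _ - _ = c n * ((`|x - a n| - `|y - a n|) - sg n * (x - y))); last by ring.
  rewrite normrM -[leRHS]mul1r ler_pM//.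
  apply: le_trans (ler_normB _ _) _; rewrite mulr_natl mulr2n lerD//.
    apply: le_trans (ler_dist_dist _ _) _.
    by rewrite opprB addrA subrK.
  by rewrite normrM -[leRHS]mul1r ler_pM.
rewrite (_ : _ - _ = c n * ((`|x - a n| - `|y - a n|) - sg n * (x - y))); last by ring.
by rewrite Hd// subrr mulr0.
Qed.

(** Only points up to [t] are seen, so a kink located at [t] itself has slope [-1], as do those to
    its right. *)
Lemma kink_sum_left (R : realType) (c a : nat -> R) (t : R) :
  (forall n, `|c n| <= 1) ->
  strict_deriv [set x | x <= t] (kink_sum c a) t
    (wsum (fun n => c n * (if t <= a n then -1 else 1))).
Proof.
move=> c1; apply: kink_sum_strict => // n.
  by case: ifP; rewrite ?normrN normr1.
case: leP => ta.
  exists 1 => // x y /= xt yt _ _.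
  by rewrite !ler0_norm ?subr_le0; lra.
exists (t - a n); rewrite ?subr_gt0// => x y /= xt yt.
by rewrite !ltr_norml => /andP[x1 _] /andP[y1 _]; rewrite !gtr0_norm; lra.
Qed.

Lemma kink_sum_right (R : realType) (c a : nat -> R) (t : R) :
  (forall n, `|c n| <= 1) ->
  strict_deriv [set x | t <= x] (kink_sum c a) t
    (wsum (fun n => c n * (if a n <= t then 1 else -1))).
Proof.
move=> c1; apply: kink_sum_strict => // n.
  by case: ifP; rewrite ?normrN normr1.
case: leP => ta.
  exists 1 => // x y /= xt yt _ _.
  by rewrite !ger0_norm ?subr_ge0; lra.
exists (a n - t); rewrite ?subr_gt0// => x y /= xt yt.
by rewrite !ltr_norml => /andP[_ x1] /andP[_ y1]; rewrite !ltr0_norm; lra.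
Qed.

Lemma kink_sum_derivable (R : realType) (c a : nat -> R) (t : R) :
  (forall n, `|c n| <= 1) -> (forall n, a n != t) ->
  derivable (kink_sum c a) t 1.
Proof.
move=> c1 at_; apply: (@strict_deriv_derivable _ _ _
    (wsum (fun n => c n * (if a n <= t then 1 else -1)))).
apply: kink_sum_strict => // n.
  by case: ifP; rewrite ?normrN normr1.
have := at_ n; case: ltgtP => // ta _.
  exists (t - a n); rewrite ?subr_gt0// => x y /= xt yt.
  by rewrite !ltr_norml => /andP[x1 _] /andP[y1 _]; rewrite !gtr0_norm; lra.
exists (a n - t); rewrite ?subr_gt0// => x y /= xt yt.
by rewrite !ltr_norml => /andP[_ x1] /andP[_ y1]; rewrite !ltr0_norm; lra.
Qed.

(** Termwise, the sign is a subgradient of the [n]-th kink at [x]. It does not depend on [c], so the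
    subgradients for different coefficients combine linearly. *)
Lemma kink_sum_subgradient (R : realType) (c a : nat -> R) (x y : R) :
  bounded_seq c -> (forall n, 0 <= c n) ->
  kink_sum c a x + wsum (fun n => c n * (if a n <= x then 1 else -1)) * (y - x)
    <= kink_sum c a y.
Proof.
move=> bc c0.
have bs : bounded_seq (fun n => c n * (if a n <= x then 1 else -1)).
  apply: bounded_seqM => //; exists 1 => n.
  by case: ifP; rewrite ?normrN normr1.
rewrite /kink_sum mulrC -wsumZ// -wsumD//; first last.
- exact: bounded_seqZ.
- exact: bounded_kink.
apply: ler_wsum; [|exact: bounded_kink|].
  have [A HA] := bounded_kink a x bc; have [B HB] := bounded_seqZ (y - x) bs.
  by exists (A + B) => n; apply: le_trans (ler_normD _ _) _; rewrite lerD.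
move=> n; rewrite mulrCA -mulrDr ler_wpM2l//.
have := ler_norm (y - a n); have := ler_norm (- (y - a n)); rewrite normrN => y1 y2.
case: (leP (a n) x) => ax.
  by rewrite (@ger0_norm _ (x - a n)) ?subr_ge0//; lra.
by rewrite (@ltr0_norm _ (x - a n)) ?subr_lt0//; lra.
Qed.

Lemma kink_sumD (R : realType) (c c' a : nat -> R) (x : R) :
  bounded_seq c -> bounded_seq c' ->
  kink_sum (fun n => c n + c' n) a x = kink_sum c a x + kink_sum c' a x.
Proof.
move=> bc bc'; rewrite /kink_sum -wsumD; [|exact: bounded_kink..].
by congr wsum; apply/funext => n; rewrite mulrDl.
Qed.

Lemma kink_sumZ (R : realType) (c a : nat -> R) (k x : R) :
  bounded_seq c -> kink_sum (fun n => k * c n) a x = k * kink_sum c a x.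
Proof.
move=> bc; rewrite /kink_sum -wsumZ; last exact: bounded_kink.
by congr wsum; apply/funext => n; rewrite mulrA.
Qed.

(** An interval of positive length is not a null set, whereas countable sets are. *)
Lemma countable_avoid (R : realType) (D : set R) (x y : R) :
  countable D -> x < y -> exists2 s, x < s < y & ~ D s.
Proof.
move=> cD xy; apply: contrapT => H.
have sub : `]x, y[%classic `<=` D.
  move=> s /=; rewrite in_itv/= => sxy; apply: contrapT => Ds.
  by apply: H; exists s.
have := countable_lebesgue_measure0 (sub_countable (subset_card_le sub) cD).
rewrite lebesgue_measure_itv /= lte_fin xy -EFinD => -[] /eqP.
by rewrite subr_eq0 gt_eqF.
Qed.

(** The sign is attached to the point and not to its index, so that repetitions in the enumeration
    cannot cancel each other. *)
Definition rational_sign {R : realType} (t : R) : R :=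
  if `[< rational t >] then 1 else -1.

Lemma kink_points (R : realType) : exists a : nat -> R,
  forall x y, x < y ->
    (exists2 n, x < a n < y & rational_sign (a n) = 1) /\
    (exists2 n, x < a n < y & rational_sign (a n) = -1).
Proof.
have cQ : countable (@rational R) by exact: (sub_countable (card_image_le _ _) (countableP _)).
have [tau _ itau] := countable_avoid cQ (@ltr01 R).
(* The rationals carry the sign [1]; their translates by the irrational [tau] are dense as well and
   carry the sign [-1]. Indices that encode nothing are sent to [0]. *)
pose pt (v : bool * rat) : R := ratr v.2 + (if v.1 then tau else 0).
exists (fun n => if unpickle n is Some v then pt v else 0) => x y xy; split.
  have [q] := rat_in_itvoo xy; rewrite in_itv/= => qxy.
  exists (pickle (false, q)); rewrite pickleK /pt/= addr0//.
  by rewrite /rational_sign asboolT//; exists q.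
have : x - tau < y - tau by rewrite ltrD2r.
move=> /rat_in_itvoo[q]; rewrite in_itv/= => /andP[q1 q2].
exists (pickle (true, q)); rewrite pickleK /pt/=.
  by rewrite -ltrBlDr q1 -ltrBrDr q2.
rewrite /rational_sign asboolF// => -[q' _ qq']; apply: itau.
by exists (q' - q) => //; rewrite rmorphB/= qq' addrC addKr.
Qed.

(** If [J] were finite it would be closed, and a point outside [J] would have a neighbourhood free
    of [J], against density. *)
Lemma infinite_dense (R : realType) (J : set R) (a b : R) :
  a < b -> (forall x y, a <= x -> x < y -> y <= b -> exists2 s, x < s < y & J s) ->
  infinite_set J.
Proof.
move=> ab H fJ.
have [s /andP[s1 s2] Js] := countable_avoid (finite_set_countable fJ) ab.
have /closed_openC oJ : closed J.
  have [+ _] := @accessible_finite_set_closed R; apply=> //.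
  exact/hausdorff_accessible/Rhausdorff.
have /nbhs_ballP[e /= e0 eJ] : nbhs s (~` J) by exact: open_nbhs_nbhs.
have [||z /andP[z1 z2]] := H s (Num.min (s + e) b) (ltW s1).
- by rewrite lt_min ltrDl e0.
- by rewrite ge_min lexx orbT.
apply: eJ; rewrite /ball/= distrC gtr0_norm ?subr_gt0// ltrBlDl.
by move: z2; rewrite lt_min => /andP[].
Qed.

Lemma sign_bound (R : realType) (P : bool) : `|if P then 1 else -1 : R| <= 1.
Proof. by case: P; rewrite ?normrN normr1. Qed.

Lemma kink_sum_bound (R : realType) (c a : nat -> R) (B x : R) :
  (forall n, `|c n| <= B) -> `|kink_sum c a x| <= B * `|x|.
Proof.
move=> cB; apply: wsum_le => n; rewrite normrM ler_pM//.
rewrite -(normrN (a n)); apply: le_trans (ler_dist_dist _ _) _.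
by rewrite opprK subrK.
Qed.

(** The sign of [e] selects the direction of the corner. Indices with [a n != a k] contribute the
    same slope on both sides; the others contribute jumps that do not oppose that of [k]. *)
Lemma kink_sum_corner (R : realType) (c a : nat -> R) (k : nat) (e : R) :
  (forall n, `|c n| <= 1) -> (forall n, a n = a k -> 0 <= e * c n) ->
  0 < e * c k ->
  exists l r, [/\ strict_deriv [set x | x <= a k] (kink_sum c a) (a k) l,
    strict_deriv [set x | a k <= x] (kink_sum c a) (a k) r & e * l < e * r].
Proof.
move=> c1 cp ck; do 2 eexists; split; [exact: kink_sum_left|exact: kink_sum_right|].
have bc : bounded_seq c by exists 1.
have bl : bounded_seq (fun n => c n * (if a k <= a n then -1 else 1)).
  by apply: bounded_seqM => //; exists 1 => n; case: ifP; rewrite ?normrN normr1.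
have br : bounded_seq (fun n => c n * (if a n <= a k then 1 else -1)).
  by apply: bounded_seqM => //; exists 1 => n; exact: sign_bound.
rewrite -subr_gt0 -mulrBr -wsumB// -wsumZ; last first.
  have [A HA] := bl; have [B HB] := br.
  by exists (B + A) => n; apply: le_trans (ler_normB _ _) _; rewrite lerD.
apply: (@wsum_gt0 _ _ k).
- apply: bounded_seqZ; have [A HA] := bl; have [B HB] := br.
  by exists (B + A) => n; apply: le_trans (ler_normB _ _) _; rewrite lerD.
- move=> n; case: (ltgtP (a k) (a n)) => kn; first by rewrite subrr mulr0.
    by rewrite subrr mulr0.
  by have := cp n (esym kn); lra.
- by rewrite lexx; lra.
Qed.

(** The coefficients are [1/4] for [G] and plus or minus [1/4] for [f], so those of [G + f] and
    [G - f] are [0] or [1/2]: both are convex. The numbers [a] and [b] are slopes of [f] and [G] at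
    [x]. *)
Lemma jump_profile (R : realType) : exists f G : R -> R,
  [/\ forall x, exists a b, [/\ `|a| <= 4^-1, `|b| <= 4^-1,
        forall y, G x + f x + (b + a) * (y - x) <= G y + f y &
        forall y, G x - f x + (b - a) * (y - x) <= G y - f y],
      forall x, `|G x| <= 4^-1 * `|x|,
      forall x y, x < y -> exists s, x < s < y /\ derivable f s 1,
      forall x y, x < y -> exists t l r, [/\ x < t < y,
        strict_deriv [set x | x <= t] f t l,
        strict_deriv [set x | t <= x] f t r & l < r] &
      forall x y, x < y -> exists t l r, [/\ x < t < y,
        strict_deriv [set x | x <= t] f t l,
        strict_deriv [set x | t <= x] f t r & r < l]].
Proof.
have [a Ha] := kink_points R.
pose u (_ : nat) : R := 4^-1.
pose v n : R := 4^-1 * rational_sign (a n).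
have q0 : 0 <= 4^-1 :> R by lra.
have uq n : `|u n| <= 4^-1 by rewrite ger0_norm.
have vq n : `|v n| <= 4^-1.
  by rewrite normrM (ger0_norm q0) ler_piMr// sign_bound.
have v1 n : `|v n| <= 1 by apply: le_trans (vq n) _; lra.
have bu : bounded_seq u by exists 4^-1.
have bv : bounded_seq v by exists 4^-1.
have bvN : bounded_seq (fun n => -1 * v n) by exact: bounded_seqZ.
exists (kink_sum v a), (kink_sum u a); split.
- move=> x; pose sg n : R := if a n <= x then 1 else -1.
  have sg1 n : `|sg n| <= 1 by exact: sign_bound.
  have bsg : bounded_seq sg by exists 1.
  exists (wsum (fun n => v n * sg n)), (wsum (fun n => u n * sg n)); split.
  + by apply: wsum_le => n; rewrite normrM -[leRHS]mulr1 ler_pM.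
  + by apply: wsum_le => n; rewrite normrM -[leRHS]mulr1 ler_pM.
  + move=> y; rewrite -!kink_sumD// -(wsumD (bounded_seqM bu bsg) (bounded_seqM bv bsg)).
    have -> : (fun n => u n * sg n + v n * sg n) = (fun n => (u n + v n) * sg n).
      by apply/funext => n; rewrite mulrDl.
    apply: kink_sum_subgradient; first exact: bounded_seqD.
    by move=> n; rewrite /u /v /rational_sign; case: ifP => _; lra.
  + move=> y.
    have E z : kink_sum u a z - kink_sum v a z = kink_sum (fun n => u n + -1 * v n) a z.
      by rewrite (kink_sumD _ _ bu bvN) (kink_sumZ _ _ _ bv) mulN1r.
    rewrite !E -(wsumB (bounded_seqM bu bsg) (bounded_seqM bv bsg)).
    have -> : (fun n => u n * sg n - v n * sg n) = (fun n => (u n + -1 * v n) * sg n).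
      by apply/funext => n; rewrite mulrDl mulN1r mulNr.
    apply: kink_sum_subgradient; first exact: bounded_seqD.
    by move=> n; rewrite /u /v /rational_sign; case: ifP => _; lra.
- by move=> x; exact: kink_sum_bound.
- move=> x y xy; have crange : countable (range a).
    exact: (sub_countable (card_image_le _ _) (countableP _)).
  have [s sxy Ns] := countable_avoid crange xy; exists s; split=> //.
  apply: kink_sum_derivable => // n; apply/eqP => ans; apply: Ns.
  by exists n.
- move=> x y /Ha[[n axy an] _].
  have [||l [r [Hl Hr lr]]] := @kink_sum_corner _ v a n 1 v1.
  + by move=> m amn; rewrite /v amn an; lra.
  + by rewrite /v an; lra.
  by exists (a n), l, r; split=> //; lra.
- move=> x y /Ha[_ [n axy an]].
  have [||l [r [Hl Hr lr]]] := @kink_sum_corner _ v a n (-1) v1.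
  + by move=> m amn; rewrite /v amn an; lra.
  + by rewrite /v an; lra.
  by exists (a n), l, r; split=> //; lra.
Qed.

(** * The Euclidean plane *)

Section euclidean_plane.
Context {R : realType}.
Local Notation enorm := (@euclid_norm R).
Implicit Types (p q u v c e : R * R) (r : R).

Definition dotp u v : R := u.1 * v.1 + u.2 * v.2.

Lemma euclid_norm_ge0 u : 0 <= enorm u.
Proof. exact: sqrtr_ge0. Qed.

Lemma sqr_euclid_norm u : enorm u ^+ 2 = u.1 ^+ 2 + u.2 ^+ 2.
Proof. by rewrite sqr_sqrtr// addr_ge0// sqr_ge0. Qed.

Lemma euclid_norm_lt u r : 0 <= r -> (enorm u < r) = (u.1 ^+ 2 + u.2 ^+ 2 < r ^+ 2).
Proof.
by move=> r0; rewrite -sqr_euclid_norm ltr_sqr ?nnegrE// euclid_norm_ge0.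
Qed.

Lemma euclid_norm_le u r : 0 <= r -> (enorm u <= r) = (u.1 ^+ 2 + u.2 ^+ 2 <= r ^+ 2).
Proof.
by move=> r0; rewrite -sqr_euclid_norm ler_sqr ?nnegrE// euclid_norm_ge0.
Qed.

Lemma le_euclid_norm u r : 0 <= r -> (r <= enorm u) = (r ^+ 2 <= u.1 ^+ 2 + u.2 ^+ 2).
Proof.
by move=> r0; rewrite -sqr_euclid_norm ler_sqr ?nnegrE// euclid_norm_ge0.
Qed.

Lemma euclid_norm_eq u r : 0 <= r -> u.1 ^+ 2 + u.2 ^+ 2 = r ^+ 2 -> enorm u = r.
Proof. by move=> r0 ur; rewrite /euclid_norm ur sqrtr_sqr ger0_norm. Qed.

Lemma cauchy_schwarz u v : dotp u v <= enorm u * enorm v.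
Proof.
apply: (le_trans (ler_norm _)).
rewrite -ler_sqr ?nnegrE ?mulr_ge0 ?euclid_norm_ge0//.
rewrite real_normK ?num_real// exprMn !sqr_euclid_norm /dotp.
by rewrite -subr_ge0 (_ : _ - _ = (u.1 * v.2 - u.2 * v.1) ^+ 2) ?sqr_ge0//; ring.
Qed.

Lemma euclid_normD u v : enorm (u + v) <= enorm u + enorm v.
Proof.
rewrite euclid_norm_le ?addr_ge0 ?euclid_norm_ge0//= [leRHS]sqrrD !sqr_euclid_norm.
by have := cauchy_schwarz u v; rewrite /dotp -mulr_natl; lra.
Qed.

Lemma euclid_normZ (t : R) u : enorm (t *: u) = `|t| * enorm u.
Proof.
apply: euclid_norm_eq; first by rewrite mulr_ge0// euclid_norm_ge0.
by rewrite [RHS]exprMn real_normK ?num_real// sqr_euclid_norm/= /GRing.scale/=; ring.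
Qed.

Lemma euclid_normN u : enorm (- u) = enorm u.
Proof. by rewrite /euclid_norm /= !sqrrN. Qed.

Lemma euclid_distC u v : enorm (u - v) = enorm (v - u).
Proof. by rewrite -euclid_normN opprB. Qed.

Lemma euclid_triangle w u v : enorm (u - v) <= enorm (u - w) + enorm (w - v).
Proof. by rewrite -{1}(subrK w u) -addrA euclid_normD. Qed.

Lemma normr_le_euclid u : `|u| <= enorm u.
Proof.
rewrite /Num.Def.normr/= ge_max; apply/andP; split;
  rewrite le_euclid_norm ?normr_ge0// real_normK ?num_real//.
  by rewrite lerDl sqr_ge0.
by rewrite lerDr sqr_ge0.
Qed.

Lemma euclid_le_normr u : enorm u <= 2 * `|u|.
Proof.
have [u1 u2] : `|u.1| <= `|u| /\ `|u.2| <= `|u|.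
  by rewrite /Num.Def.normr/= !le_max !lexx orbT.
rewrite euclid_norm_le ?mulr_ge0//.
rewrite -(real_normK (num_real u.1)) -(real_normK (num_real u.2)).
have := normr_ge0 u.1; have := normr_ge0 u.2; nra.
Qed.

(** * Convex open sets and their tangent half-planes *)

Definition plane_convex (A : set (R * R)) : Prop := forall p q (t : R),
  0 <= t <= 1 -> A p -> A q -> A (t *: p + (1 - t) *: q).

Definition euclid_open (A : set (R * R)) : Prop := forall p, A p ->
  exists2 d : R, 0 < d & forall q, enorm (q - p) < d -> A q.

Lemma euclid_openP (A : set (R * R)) : euclid_open A -> open A.
Proof.
move=> oA; rewrite openE => p /oA[d d0 dA].
apply/nbhs_ballP; exists (d / 2) => /=; first by rewrite divr_gt0.
move=> q; rewrite -ball_normE /= => pq; apply: dA.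
rewrite euclid_distC; apply: le_lt_trans (euclid_le_normr _) _.
by rewrite mulrC -ltr_pdivlMr.
Qed.

(* Otherwise [q] can be pushed strictly to the wrong side, and then [Q] lies
   on a segment from [q] to a point of the ball. *)
Lemma tangent_half_plane (A : set (R * R)) c Q r q :
  plane_convex A -> euclid_open A -> 0 < r ->
  (forall q, enorm (q - c) < r -> A q) -> ~ A Q -> enorm (Q - c) = r ->
  A q -> 0 < dotp (q - Q) (c - Q).
Proof.
move=> cA oA r0 bA NQ Qr Aq; rewrite ltNge; apply/negP => dle.
have Er : (c - Q).1 ^+ 2 + (c - Q).2 ^+ 2 = r ^+ 2.
  by rewrite -sqr_euclid_norm euclid_distC Qr.
have [d d0 dA] := oA _ Aq.
pose ep := d / (2 * r).
have ep0 : 0 < ep by rewrite divr_gt0// mulr_gt0.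
(* The push has length [d / 2], so it stays in [A]. *)
pose q' := q - ep *: (c - Q).
have Aq' : A q'.
  apply: dA; rewrite /q' addrAC subrr add0r euclid_normN euclid_normZ gtr0_norm//.
  rewrite euclid_distC Qr (_ : ep * r = d / 2); first by lra.
  by rewrite /ep; field; rewrite gt_eqF.
pose w := q' - Q; pose s := dotp w (c - Q).
have s0 : s < 0.
  have -> : s = dotp (q - Q) (c - Q) - ep * r ^+ 2.
    by rewrite -Er /s /w /q' /dotp /= /GRing.scale/=; ring.
  by rewrite subr_lt0 (le_lt_trans dle)// mulr_gt0// exprn_gt0.
pose W := w.1 ^+ 2 + w.2 ^+ 2.
have W0 : 0 < W.
  rewrite lt_neqAle addr_ge0 ?sqr_ge0// andbT eq_sym paddr_eq0 ?sqr_ge0//.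
  rewrite !sqrf_eq0; apply/negP => /andP[/eqP w1 /eqP w2].
  by move: s0; rewrite /s /dotp w1 w2; lra.
(* This minimises [r ^+ 2 + 2 * la * s + la ^+ 2 * W], the squared distance from [Q - la *: w] to
   [c]; as [s < 0], the minimum is below [r ^+ 2]. *)
pose la := - s / W.
have la0 : 0 < la by rewrite divr_gt0// oppr_gt0.
have Ab : A (Q - la *: w).
  apply: bA; rewrite euclid_norm_lt ?ltW//=.
  rewrite (_ : _ + _ = r ^+ 2 + 2 * la * s + la * (la * W)); last first.
    by rewrite -Er /s /W /dotp /= /GRing.scale/=; ring.
  rewrite /la divfK ?gt_eqF// -/la; nra.
apply: NQ.
have la1 : 1 + la != 0 by rewrite gt_eqF// addr_gt0.
have -> : Q = (1 + la)^-1 *: (Q - la *: w) + (1 - (1 + la)^-1) *: q'.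
  by rewrite [RHS]surjective_pairing [LHS]surjective_pairing /w/= /GRing.scale/=;
    congr pair; field.
by apply: cA => //; rewrite invr_ge0 invf_le1 ?addr_gt0//; lra.
Qed.

End euclidean_plane.

(** * Unions of balls *)

Section ball_union.
Context {R : realType}.
Local Notation enorm := (@euclid_norm R).
Implicit Types (p q Q c e : R * R) (f r : R -> R).

Definition ball_union f r : set (R * R) :=
  [set p | exists2 x, 0 <= x <= 1 & enorm (p - (x, f x)) < r x].

Lemma ball_union_open f r : euclid_open (ball_union f r).
Proof.
move=> p [x x01 px]; exists (r x - enorm (p - (x, f x))); first by rewrite subr_gt0.
move=> q qp; exists x => //; apply: le_lt_trans (euclid_triangle p _ _) _.
by rewrite -ltrBrDr.
Qed.

(* [(p, x) |-> r x - |p - (x, f x)|] is jointly concave as soon as both [r + f]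
   and [r - f] are concave. *)
Lemma ball_union_convex f r :
  (forall x y t, 0 <= x <= 1 -> 0 <= y <= 1 -> 0 <= t <= 1 ->
    let z := t * x + (1 - t) * y in
    t * r x + (1 - t) * r y + `|t * f x + (1 - t) * f y - f z| <= r z) ->
  plane_convex (ball_union f r).
Proof.
move=> H p q t t01 [x x01 px] [y y01 qy]; have /andP[t0 t1] := t01.
exists (t * x + (1 - t) * y).
  by move: x01 y01 => /andP[? ?] /andP[? ?]; apply/andP; split; nra.
apply: lt_le_trans (H _ _ _ x01 y01 t01).
set z := t * x + _; set k := t * f x + (1 - t) * f y - f z.
rewrite (_ : _ - _ = (t *: (p - (x, f x)) + (1 - t) *: (q - (y, f y))) + (0, k)); last first.
  rewrite [LHS]surjective_pairing [RHS]surjective_pairing /k /z/= /GRing.scale/=.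
  by congr pair; ring.
apply: le_lt_trans (euclid_normD _ _) _.
rewrite (@euclid_norm_eq _ (0, k) `|k|)//; last first.
  by rewrite /= expr0n/= add0r real_normK ?num_real.
rewrite ltrD2r; apply: le_lt_trans (euclid_normD _ _) _.
rewrite !euclid_normZ !ger0_norm ?subr_ge0//.
have [t12|t12] := leP t 2^-1.
  by apply: ler_ltD; [rewrite ler_wpM2l// ltW|rewrite ltr_pM2l//; lra].
by apply: ltr_leD; [rewrite ltr_pM2l//; lra|rewrite ler_wpM2l ?subr_ge0// ltW].
Qed.

(** The depth [phi x] of [Q] in the ball of index [x] is continuous, hence has a maximum on the unit
    interval. It is not positive since [Q] is outside; if it were negative, points close to [Q]
    would be outside every ball too. *)
Lemma ball_union_touch f r Q :
  (forall x y, `|f x - f y| <= `|x - y|) -> (forall x y, `|r x - r y| <= `|x - y|) ->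
  (forall d, 0 < d -> exists2 p, ball_union f r p & enorm (p - Q) < d) ->
  ~ ball_union f r Q ->
  exists2 x, 0 <= x <= 1 & enorm (Q - (x, f x)) = r x.
Proof.
move=> fL rL cQ NQ; pose phi x := r x - enorm (Q - (x, f x)).
have phiL x y : `|phi x - phi y| <= 3 * `|x - y|.
  have aux u v : enorm (Q - (u, f u)) <= enorm (Q - (v, f v)) + 2 * `|u - v|.
    apply: le_trans (euclid_triangle (v, f v) _ _) _; rewrite lerD2l.
    apply: le_trans (euclid_le_normr _) _.
    by rewrite ler_wpM2l// /Num.Def.normr/= ge_max distrC lexx distrC fL.
  have := aux x y; have := aux y x; have := rL x y; rewrite (distrC y x) !ler_norml /phi.
  by move=> /andP[? ?] ? ?; apply/andP; split; lra.
have cphi : continuous phi.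
  move=> x; apply/cvgrPdist_lt => eta eta0.
  apply/nbhs_ballP; exists (eta / 3) => /=; first by rewrite divr_gt0.
  move=> y xy; apply: le_lt_trans (phiL x y) _.
  by rewrite mulrC -ltr_pdivlMr.
have [x xI Hx] := EVT_max (@ler01 R) (continuous_subspaceT cphi).
have x01 : 0 <= x <= 1 by move: xI; rewrite in_itv.
exists x => //; apply/eqP; rewrite eq_le andbC; apply/andP; split.
  by rewrite leNgt; apply/negP => h; apply: NQ; exists x.
rewrite leNgt; apply/negP => h.
have [p [y y01 py] pQ] := cQ (enorm (Q - (x, f x)) - r x) ltac:(by rewrite subr_gt0).
have := Hx y; rewrite in_itv/= y01 => /(_ isT); rewrite /phi.
have := euclid_triangle p Q (y, f y); rewrite (euclid_distC Q p).
by lra.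
Qed.

(* [t |-> (b - t a, t)] meets the unit circle at two points, since it starts
   inside the unit disc at [t = 0]. *)
Lemma two_unit_normals (a b : R) : `|b| < 1 ->
  exists s t : R, [/\ s != t, (b - s * a) ^+ 2 + s ^+ 2 = 1 &
    (b - t * a) ^+ 2 + t ^+ 2 = 1].
Proof.
rewrite ltr_norml => /andP[b1 b2].
(* A quarter of the discriminant of [(1 + a ^+ 2) * s ^+ 2 - 2 * a * b * s + b ^+ 2 - 1]. *)
pose D := a ^+ 2 * b ^+ 2 + (1 + a ^+ 2) * (1 - b ^+ 2).
have D0 : 0 < D.
  by apply: ltr_wpDl; [rewrite mulr_ge0// sqr_ge0|rewrite mulr_gt0//; nra].
have sD : Num.sqrt D ^+ 2 = D by rewrite sqr_sqrtr// ltW.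
have s0 : 0 < Num.sqrt D by rewrite sqrtr_gt0.
have a0 : 0 < 1 + a ^+ 2 by nra.
have key w : w ^+ 2 = D -> let s := (a * b + w) / (1 + a ^+ 2) in
    (b - s * a) ^+ 2 + s ^+ 2 = 1.
  move=> wD s.
  have E : s * (1 + a ^+ 2) = a * b + w by rewrite /s divfK// gt_eqF.
  apply: (mulfI (x := 1 + a ^+ 2)); first by rewrite gt_eqF.
  transitivity ((s * (1 + a ^+ 2) - a * b) ^+ 2 + b ^+ 2 * (1 + a ^+ 2) - a ^+ 2 * b ^+ 2); first by ring.
  by rewrite E (addrC (a * b)) addrK wD /D; ring.
exists ((a * b + Num.sqrt D) / (1 + a ^+ 2)), ((a * b - Num.sqrt D) / (1 + a ^+ 2)).
split; [|exact: key|by apply: key; rewrite sqrrN].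
rewrite -subr_eq0 -mulrBl mulf_neq0 ?invr_neq0 ?gt_eqF//.
by rewrite opprD opprK addrA; lra.
Qed.

(** Think of [a] and [- b] as slopes of [f] and [r] at [x]. For a unit vector [(b - s * a, s)], the
    support function of the ball of index [y] in that direction is largest at [y = x]: add the two
    inequalities with weights [1 + s] and [1 - s]. So the union does not cross the tangent line at
    the contact point. *)
Lemma ball_union_contact f r x a b s :
  `|s| <= 1 ->
  (forall y, r y + f y <= r x + f x - (b - a) * (y - x)) ->
  (forall y, r y - f y <= r x - f x - (b + a) * (y - x)) ->
  (b - s * a) ^+ 2 + s ^+ 2 = 1 ->
  ~ ball_union f r ((x, f x) + r x *: (b - s * a, s)).
Proof.
rewrite ler_norml => /andP[s1 s2] Hp Hm es [y _].
have := cauchy_schwarz ((x, f x) + r x *: (b - s * a, s) - (y, f y)) (b - s * a, s).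
rewrite (@euclid_norm_eq _ (b - s * a, s) 1)//; last by rewrite expr1n.
rewrite mulr1 => cs /(le_lt_trans cs); apply/negP; rewrite -leNgt /dotp/= /GRing.scale/=.
have -> : (x + r x * (b - s * a) - y) * (b - s * a) + (f x + r x * s - f y) * s =
    r x * ((b - s * a) ^+ 2 + s ^+ 2) - (y - x) * (b - s * a) + (f x - f y) * s by ring.
rewrite es.
have Hp' : (1 + s) * (r y + f y) <= (1 + s) * (r x + f x - (b - a) * (y - x)).
  by rewrite ler_wpM2l//; lra.
have Hm' : (1 - s) * (r y - f y) <= (1 - s) * (r x - f x - (b + a) * (y - x)).
  by rewrite ler_wpM2l//; lra.
lra.
Qed.

End ball_union.

(** * Differentiability of the distance function *)

Section distance.
Context {R : realType}.
Local Notation enorm := (@euclid_norm R).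
Implicit Types (p q Q c e l h : R * R) (A : set (R * R)).

Lemma dotp_linear l : linear (dotp l).
Proof. by move=> k u v; rewrite /dotp/= /GRing.scale/=; ring. Qed.

HB.instance Definition _ l :=
  GRing.isLinear.Build R (R * R)%type R _ (dotp l) (dotp_linear l).

Lemma dotp_continuous l : continuous (dotp l).
Proof.
move=> p; apply: cvgD; apply: cvgM; try exact: cvg_cst.
  exact: cvg_fst.
exact: cvg_snd.
Qed.

Lemma differentiable_quadratic (d : R * R -> R) p l (K : R) :
  (forall h, `|d (p + h) - d p - dotp l h| <= K * enorm h ^+ 2) ->
  differentiable d p.
Proof.
move=> H.
have E : (d \o shift p : R * R -> R) = (cst (d p) + dotp l : R * R -> R) +o_ (0 : R * R) (id : R * R -> R * R).
  apply/eqaddoP => _/posnumP[eta].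
  near=> h.
  have := H h; set z := d _ - _ - _ => Hz.
  rewrite [X in `|X| <= _](_ : _ = z); last first.
    rewrite /z (addrC p h) -addrA -opprD; reflexivity.
  apply: le_trans Hz _.
  have hn : enorm h ^+ 2 <= 4 * `|h| ^+ 2.
    have := euclid_le_normr h; have := euclid_norm_ge0 h; nra.
  have Kh : `|K| * 4 * `|h| <= eta%:num.
    have hs : `|h| < eta%:num / (`|K| * 4 + 1).
      near: h; apply/nbhs_ballP; exists (eta%:num / (`|K| * 4 + 1)) => /=.
        by rewrite divr_gt0// ltr_wpDl// mulr_ge0.
      by move=> z; rewrite -ball_normE /= sub0r normrN.
    move: hs; rewrite ltr_pdivlMr; last by rewrite ltr_wpDl// mulr_ge0.
    by have := normr_ge0 h; lra.
  apply: (@le_trans _ _ (`|K| * enorm h ^+ 2)).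
    by rewrite ler_wpM2r ?sqr_ge0// ler_norm.
  have := normr_ge0 K; have := normr_ge0 h; nra.
have U := diff_unique (@dotp_continuous l) E.
apply/diff_locallyP; rewrite U; split => //.
exact: dotp_continuous.
Unshelve. all: by end_near. Qed.

(** The directional derivative along [h] is at most [dotp l h]; applying this to [- h] as well gives
    equality. *)
Lemma diff_upper_quadratic (d : R * R -> R) p l (K : R) :
  differentiable d p ->
  (forall h, d (p + h) <= d p + dotp l h + K * enorm h ^+ 2) ->
  forall h, 'd d p h = dotp l h.
Proof.
move=> dd H.
have le h : 'd d p h <= dotp l h.
  rewrite -deriveE//.
  have cv : (fun t : R => t^-1 *: ((d \o shift p) (t *: h) - d p)) @ 0^'
      --> 'D_h d p.
    exact: diff_derivable.
  have cvr : (fun t : R => dotp l h + K * t * enorm h ^+ 2) @ 0^'+ --> dotp l h.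
    rewrite -[X in _ --> X]addr0; apply: cvgD; first exact: cvg_cst.
    rewrite -[X in _ --> X](mul0r (enorm h ^+ 2)); apply: cvgMl.
    rewrite -[X in _ --> X](mulr0 K); apply: cvgMr.
    exact: cvg_at_right_filter.
  apply: (ler_cvg_to (cvg_dnbhs_at_right cv) cvr).
  near=> t.
  have t0 : 0 < t by near: t; exact: nbhs_right_gt.
  have := H (t *: h); rewrite euclid_normZ exprMn real_normK ?num_real//.
  have -> : dotp l (t *: h) = t * dotp l h.
    by rewrite /dotp/= /GRing.scale/=; ring.
  move=> Ht.
  rewrite /GRing.scale/= ler_pdivrMl// [_ + p]addrC.
  by move: Ht; rewrite /GRing.scale/=; lra.
move=> h; apply/eqP; rewrite eq_le le/=.
have := le (- h); rewrite linearN.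
by rewrite (_ : dotp l (- h) = - dotp l h) ?lerN2// /dotp/=; ring.
Unshelve. all: by end_near. Qed.

(** After squaring, with [y] the last term, the two sides differ by [(dotp e h + y) ^+ 2]. The right
    side is nonnegative because [2 * k] times it is at least [(k - enorm h) ^+ 2 + k ^+ 2]. *)
Lemma euclid_norm_expand e h (k : R) : 0 < k -> enorm e = 1 ->
  enorm (k *: e + h) <= k + dotp e h + enorm h ^+ 2 / (2 * k).
Proof.
move=> k0 e1; have e2 : e.1 ^+ 2 + e.2 ^+ 2 = 1 by rewrite -sqr_euclid_norm e1 expr1n.
have cs := cauchy_schwarz e (- h); rewrite e1 mul1r euclid_normN in cs.
have cs' : - enorm h <= dotp e h by move: cs; rewrite /dotp/=; lra.
set y := enorm h ^+ 2 / (2 * k).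
have yE : y * (2 * k) = enorm h ^+ 2 by rewrite /y divfK// gt_eqF// mulr_gt0.
have y0 : 0 <= y by rewrite divr_ge0 ?sqr_ge0// mulr_ge0// ltW.
have k1 : 0 <= k + dotp e h + y.
  have : 0 <= (k - enorm h) ^+ 2 + k ^+ 2 by rewrite addr_ge0 ?sqr_ge0.
  have : k * - enorm h <= k * dotp e h by rewrite ler_wpM2l// ltW.
  move=> h1 h2; have : 0 <= (k + dotp e h + y) * (2 * k) by lra.
  by rewrite pmulr_lge0// mulr_gt0.
rewrite euclid_norm_le//.
have -> : (k *: e + h).1 ^+ 2 + (k *: e + h).2 ^+ 2 =
    k ^+ 2 * (e.1 ^+ 2 + e.2 ^+ 2) + 2 * k * dotp e h + (h.1 ^+ 2 + h.2 ^+ 2).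
  by rewrite /dotp/= /GRing.scale/=; ring.
by rewrite e2 -sqr_euclid_norm -yE; have := sqr_ge0 (dotp e h + y); lra.
Qed.

(** * Nearest points and the distance function *)

Lemma euclid_dist_le (N : set (R * R)) p Q : N Q -> euclid_dist N p <= enorm (Q - p).
Proof.
move=> NQ; apply: ge_inf; last by exists Q.
by exists 0 => _ [q _ <-]; exact: euclid_norm_ge0.
Qed.

Lemma le_euclid_dist (N : set (R * R)) p (k : R) : N !=set0 ->
  (forall Q, N Q -> k <= enorm (Q - p)) -> k <= euclid_dist N p.
Proof.
move=> [Q NQ] H; apply: lb_le_inf; first by exists (enorm (Q - p)), Q.
by move=> _ [q Nq <-]; exact: H.
Qed.

Lemma euclid_dist_attained (N : set (R * R)) p : closed N -> N !=set0 ->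
  exists2 Q, N Q & enorm (Q - p) = euclid_dist N p.
Proof.
move=> cN [Q0 NQ0]; set M := enorm (Q0 - p).
pose K := `[p.1 - M, p.1 + M]%classic `*` `[p.2 - M, p.2 + M]%classic.
have KP q : enorm (q - p) <= M -> K q.
  move=> qM; have := le_trans (normr_le_euclid _) qM.
  rewrite /Num.Def.normr/= ge_max !ler_norml => /andP[/andP[? ?] /andP[? ?]].
  by split; rewrite /= in_itv/=; apply/andP; split; lra.
have cK : compact (K `&` N).
  apply: (subclosed_compact _ _ (@subIsetl _ K N)).
    apply: closedI => //; apply: compact_closed; first exact: norm_hausdorff.
    by apply: compact_setX; exact: segment_compact.
  by apply: compact_setX; exact: segment_compact.
have cf : continuous (fun q => enorm (q - p)).
  move=> q; apply/cvgrPdist_lt => eta eta0.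
  have eta2 : 0 < eta / 2 by rewrite divr_gt0.
  apply: filterS (nbhsx_ballx q _ eta2) => q'; rewrite -ball_normE/= ltr_pdivlMr// mulrC => qq'.
  apply: le_lt_trans qq'; apply: le_trans (euclid_le_normr _).
  have := euclid_triangle q q' p; have := euclid_triangle q' q p.
  rewrite (euclid_distC q' q) ler_norml => ? ?; apply/andP; split; lra.
have [|Q QK HQ] := compact_EVT_min _ cK (continuous_subspaceT cf).
  by exists Q0; split => //; exact: KP.
move: QK; rewrite inE => -[_ NQ]; exists Q => //.
apply/eqP; rewrite eq_le (euclid_dist_le _ NQ) andbT.
apply: le_euclid_dist; first by exists Q.
move=> q Nq; have [qM|Mq] := leP (enorm (q - p)) M.
  by apply: HQ; rewrite inE; split => //; exact: KP.
apply: le_trans (ltW Mq); apply: HQ; rewrite inE; split => //; exact: KP.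
Qed.

(* At an interior point of the segment from the centre of a ball inside [A] to
   a point of its boundary outside [A], the distance is squeezed between the
   distance to that sphere and the distance to that point. *)
Lemma differentiable_on_normal A c e (k t : R) :
  (forall q, enorm (q - c) < k -> A q) -> enorm e = 1 -> 0 < t < k ->
  ~ A (c + k *: e) ->
  differentiable (euclid_dist (~` A)) (c + t *: e).
Proof.
move=> bA e1 /andP[t0 tk] NQ.
have ne : (~` A) !=set0 by exists (c + k *: e).
have kt0 : 0 < k - t by rewrite subr_gt0.
have up h : euclid_dist (~` A) (c + t *: e + h) <=
    k - t - dotp e h + enorm h ^+ 2 / (2 * (k - t)).
  apply: le_trans (euclid_dist_le _ NQ) _.
  rewrite (_ : c + k *: e - _ = (k - t) *: e + (- h)); last first.
    by rewrite scalerBl opprD addrA opprD addrACA subrr add0r.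
  apply: le_trans (euclid_norm_expand _ kt0 e1) _.
  by rewrite euclid_normN; rewrite /dotp/=; lra.
have low h : k - t - dotp e h - enorm h ^+ 2 / (2 * t) <=
    euclid_dist (~` A) (c + t *: e + h).
  apply: le_euclid_dist => // Q NQ'.
  have Qk : k <= enorm (Q - c) by rewrite leNgt; apply/negP => /bA.
  have := euclid_triangle (c + t *: e + h) Q c.
  rewrite (_ : c + t *: e + h - c = t *: e + h); last by rewrite addrC addrA addKr.
  by have := euclid_norm_expand h t0 e1; lra.
have d0 : euclid_dist (~` A) (c + t *: e) = k - t.
  have := up 0; have := low 0; rewrite !addr0 /dotp/=.
  rewrite (@euclid_norm_eq _ 0 0)//=; last by rewrite expr0n/= addr0.
  by rewrite expr0n/= !mul0r !mulr0; lra.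
apply: (@differentiable_quadratic _ _ (- e) ((2 * t)^-1 + (2 * (k - t))^-1)) => h.
have := up h; have := low h; rewrite d0.
have -> : dotp (- e) h = - dotp e h by rewrite /dotp/=; ring.
have a1 : 0 <= enorm h ^+ 2 / (2 * t) by rewrite divr_ge0 ?sqr_ge0//; lra.
have a2 : 0 <= enorm h ^+ 2 / (2 * (k - t)) by rewrite divr_ge0 ?sqr_ge0//; lra.
rewrite ler_norml => ? ?; apply/andP; split; lra.
Qed.

(** The distance to one nearest point [c + k *: u] bounds the distance function from above with
    equality at [c], which forces the gradient [- u]. Two nearest points give two gradients. *)
Lemma two_nearest_not_differentiable A c e e' (k : R) :
  (forall q, enorm (q - c) < k -> A q) -> 0 < k -> enorm e = 1 -> enorm e' = 1 ->
  e != e' -> ~ A (c + k *: e) -> ~ A (c + k *: e') ->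
  ~ differentiable (euclid_dist (~` A)) c.
Proof.
move=> bA k0 e1 e1' ee' NQ NQ' dd.
have dk : euclid_dist (~` A) c = k.
  apply/eqP; rewrite eq_le; apply/andP; split.
    apply: le_trans (euclid_dist_le _ NQ) _.
    by rewrite addrAC subrr add0r euclid_normZ e1 mulr1 gtr0_norm.
  apply: le_euclid_dist; first by exists (c + k *: e).
  by move=> q Nq; rewrite leNgt; apply/negP => /bA.
have grad u : enorm u = 1 -> ~ A (c + k *: u) ->
    forall h, 'd (euclid_dist (~` A)) c h = - dotp u h.
  move=> u1 Nu h.
  rewrite (@diff_upper_quadratic _ _ (- u) (2 * k)^-1)//.
    by rewrite /dotp/=; ring.
  move=> {}h; apply: le_trans (euclid_dist_le _ Nu) _.
  rewrite (_ : c + k *: u - _ = k *: u + (- h)); last first.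
    by rewrite opprD addrACA subrr add0r.
  apply: le_trans (euclid_norm_expand _ k0 u1) _.
  by rewrite euclid_normN dk /dotp/=; lra.
move/eqP : ee'; apply.
have E h : dotp e h = dotp e' h.
  by apply: oppr_inj; rewrite -grad// -grad.
have := E (1, 0); have := E (0, 1); rewrite /dotp/= !mulr0 !mulr1 !addr0 !add0r.
by rewrite [e]surjective_pairing [e']surjective_pairing /= => -> ->.
Qed.

End distance.

(** * Regularity of the boundary *)

Section smooth_boundary.
Context {R : realType}.
Local Notation enorm := (@euclid_norm R).
Implicit Types (p q Q c e u v : R * R) (A B : set (R * R)).

Definition euclid_adherent A Q : Prop :=
  forall d : R, 0 < d -> exists2 p, A p & enorm (p - Q) < d.

(** The interior sphere condition with a uniform radius. *)
Definition inner_ball_condition A (rho : R) : Prop :=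
  forall Q, euclid_adherent A Q -> ~ A Q ->
  exists2 c, enorm (Q - c) = rho & forall q, enorm (q - c) < rho -> A q.

(** The squeeze identifies [m] as the derivative at [s]. Adding the estimates based at [s] and at
    [y] puts the product of the increment of the derivative with [y - s] between [0] and
    [2 * K * (y - s) ^+ 2]. *)
Lemma C11_parabola (g : R -> R) (r K : R) : 0 < r ->
  (forall s, -r < s < r -> exists m, forall y, -r < y < r ->
    g s + m * (y - s) <= g y <= g s + m * (y - s) + K * (y - s) ^+ 2) ->
  C11_on `]- r, r[ g.
Proof.
move=> r0 H.
have D s : -r < s < r -> derivable g s 1 /\
    forall y, -r < y < r -> g s + derive1 g s * (y - s) <= g y <=
      g s + derive1 g s * (y - s) + K * (y - s) ^+ 2.
  move=> srr; have [m Hm] := H s srr.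
  have cv : h^-1 *: ((g \o shift s) (h *: 1) - g s) @[h --> 0^'] --> m.
    apply/cvgrPdist_le => eta eta0.
    near=> h.
    have h0 : h != 0 by near: h; exact: nbhs_dnbhs_neq.
    have hs : `|h| < Num.min (s + r) (r - s).
      near: h; apply: dnbhs0_lt; rewrite lt_min.
      by move: srr => /andP[? ?]; apply/andP; split; lra.
    have hK : `|h| < eta / (`|K| + 1).
      by near: h; apply: dnbhs0_lt; rewrite divr_gt0// ltr_wpDl.
    have /Hm : - r < h + s < r.
      move: hs; rewrite lt_min !ltr_norml => /andP[/andP[? ?] /andP[? ?]].
      by apply/andP; split; lra.
    rewrite addrK => /andP[g1 g2].
    rewrite /= -(ler_pM2r (x := `|h|)) ?normr_gt0// -normrM mulrBl.
    rewrite /GRing.scale/= mulr1 (mulrC h^-1) divfK//.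
    have hK2 : K * h ^+ 2 <= eta * `|h|.
      move: hK; rewrite ltr_pdivlMr ?ltr_wpDl// => hK.
      rewrite -(real_normK (num_real h)).
      have := ler_norm K; have := normr_ge0 h; have := normr_ge0 K; nra.
    have eh : 0 <= eta * `|h| by rewrite mulr_ge0// ltW.
    by rewrite ler_norml; apply/andP; split; lra.
  have dg : derivable g s 1 by apply/cvg_ex; exists m.
  split=> // y; have -> : derive1 g s = m.
    by rewrite derive1E; exact: cvg_lim cv.
  exact: Hm.
split=> [s|]; first by rewrite /= in_itv/= => /D[].
exists (2 * K) => -[s y] /= []; rewrite !in_itv/= => sr yr.
have [_ Hs] := D s sr; have [_ Hy] := D y yr.
have /andP[s1 s2] := Hs y yr; have /andP[y1 y2] := Hy s sr.
have [->|sy] := eqVneq s y; first by rewrite !subrr !normr0 mulr0.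
have sy0 : 0 < `|s - y| by rewrite normr_gt0 subr_eq0.
rewrite -(ler_pM2r sy0) -normrM -mulrA -normrM.
rewrite [X in 2 * K * X]ger0_norm; last by rewrite -expr2 sqr_ge0.
rewrite ler_norml; apply/andP; split; nra.
Unshelve. all: by end_near. Qed.

(** Model position: boundary point at the origin, inner normal vertical. At each point of the graph,
    convexity gives a supporting line below and the inner ball gives a parabola above, with the same
    slope. *)
Lemma inner_ball_graph B (rho : R) : 0 < rho -> plane_convex B -> euclid_open B ->
  inner_ball_condition B rho ->
  (forall q, enorm (q - (0, rho)) < rho -> B q) -> ~ B 0 ->
  exists g, C11_on `]- (rho / 4), rho / 4[ g /\
    forall q, enorm q < rho / 4 -> (B q <-> g q.1 < q.2).
Proof.
move=> r0 cB oB iB bB NB.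
have Nr : enorm (0 - (0, rho)) = rho.
  by apply: euclid_norm_eq; [exact: ltW|rewrite /=; ring].
have pos q : B q -> 0 < q.2.
  move=> /(tangent_half_plane cB oB r0 bB NB Nr).
  rewrite (_ : dotp _ _ = q.2 * rho) ?pmulr_lgt0// /dotp/=; ring.
pose S s := [set t | B (s, t)].
have Slb s : has_lbound (S s) by exists 0 => t /pos/ltW.
have Srho s : -rho < s < rho -> S s rho.
  move=> /andP[s1 s2]; apply: bB; rewrite euclid_norm_lt ?ltW//=; nra.
pose g s := inf (S s).
have gP s t : -rho < s < rho -> t <= rho -> B (s, t) <-> g s < t.
  move=> srho trho; split=> [Bst|gt].
    have [d d0 dB] := oB _ Bst.
    have Bst' : B (s, t - d / 2).
      apply: dB; rewrite euclid_norm_lt ?ltW//=; nra.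
    have /le_lt_trans -> // : g s <= t - d / 2 by exact: ge_inf.
    by lra.
  (* By convexity the vertical fibre is filled up to height [rho]: [(s, t)] lies between [(s, t')]
     and the point [(s, rho)] of the horizontal diameter of the given ball. *)
  have [|t' Bt' t't] := inf_lt _ gt; first by exists rho; exact: Srho.
  have [->|tr] := eqVneq t rho; first exact: Srho.
  have t'r : t' < rho by exact: lt_le_trans trho.
  have k0 : 0 < rho - t' by rewrite subr_gt0.
  pose k := (rho - t) / (rho - t').
  have k01 : 0 <= k <= 1.
    apply/andP; split; first by rewrite divr_ge0 ?subr_ge0// ltW.
    by rewrite ler_pdivrMr// mul1r; lra.
  have := cB _ _ _ k01 Bt' (Srho _ srho).
  have kE : k * (rho - t') = rho - t by rewrite /k divfK// gt_eqF.
  rewrite (_ : k *: _ + _ = (s, t))//.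
  rewrite [LHS]surjective_pairing /= /GRing.scale/=; congr pair; first by ring.
  by lra.
exists g; split; last first.
  move=> [s t]; rewrite euclid_norm_lt/= => [st|]; last by rewrite divr_ge0// ltW.
  by apply: gP; [apply/andP; split; nra|nra].
apply: (@C11_parabola _ _ rho^-1); first by rewrite divr_gt0.
move=> s /andP[s1 s2].
have srho : -rho < s < rho by apply/andP; split; lra.
have g16 : g s < rho / 16.
  by apply/gP => //; [lra|apply: bB; rewrite euclid_norm_lt ?ltW//=; nra].
have Ng : ~ B (s, g s) by move/(gP s (g s) srho ltac:(lra)).1; rewrite ltxx.
have [|c Qc cBall] := iB (s, g s) _ Ng.
  move=> d d0; pose t := g s + Num.min (d / 2) (rho / 2).
  have m0 : 0 < Num.min (d / 2) (rho / 2) by rewrite lt_min !divr_gt0.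
  have m1 : Num.min (d / 2) (rho / 2) <= d / 2 by rewrite ge_min lexx.
  have m2 : Num.min (d / 2) (rho / 2) <= rho / 2 by rewrite ge_min lexx orbT.
  exists (s, t); first by apply/gP => //; rewrite /t; lra.
  rewrite euclid_norm_lt ?ltW//= /t; nra.
pose n1 := (c.1 - s) / rho; pose n2 := (c.2 - g s) / rho.
have c1E : c.1 = s + rho * n1 by rewrite /n1 mulrCA divff ?gt_eqF// mulr1 addrC subrK.
have c2E : c.2 = g s + rho * n2 by rewrite /n2 mulrCA divff ?gt_eqF// mulr1 addrC subrK.
have n12 : n1 ^+ 2 + n2 ^+ 2 = 1.
  have := sqr_euclid_norm ((s, g s) - c); rewrite Qc /= c1E c2E => E.
  apply: (mulfI (x := rho ^+ 2)); first by rewrite gt_eqF// exprn_gt0.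
  by rewrite mulr1 {2}E; ring.
(* The inner ball at [(s, g s)] lies in the upper half-plane, so its centre has height at least
   [rho]. As [g s < rho / 16], its normal [(n1, n2)] is then nearly vertical. *)
have c2rho : rho <= c.2.
  rewrite leNgt; apply/negP => c2.
  pose t := Num.max 0 c.2.
  have t0 : 0 <= t by rewrite le_max lexx.
  have tc : c.2 <= t by rewrite le_max lexx orbT.
  have tr : t < rho by rewrite gt_max r0.
  have /pos /= : B (c.1, c.2 - t) by apply: cBall; rewrite euclid_norm_lt ?ltW//=; nra.
  by lra.
have n2_ge : 15 / 16 <= n2 by rewrite -(ler_pM2l r0); lra.
have n20 : 0 < n2 by lra.
have n1sq : n1 ^+ 2 <= 31 / 256 by nra.
(* The slope of the line through [(s, g s)] orthogonal to [(n1, n2)]. *)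
exists (- n1 / n2) => y /andP[y1 y2]; set m := - n1 / n2.
have mE : n2 * m = - n1 by rewrite /m mulrC divfK// gt_eqF.
have yrho : -rho < y < rho by apply/andP; split; lra.
apply/andP; split.
  apply: lb_le_inf; first by exists rho; exact: Srho.
  move=> t /(tangent_half_plane cB oB r0 cBall Ng Qc).
  rewrite /dotp/= c1E c2E => h.
  have {}h : 0 < rho * (n2 * (t - (g s + m * (y - s)))).
    rewrite (_ : _ * _ = rho * n2 * (t - g s) - rho * (n2 * m) * (y - s)); last by ring.
    by rewrite mE; lra.
  by move: h; rewrite (pmulr_rgt0 _ r0) (pmulr_rgt0 _ n20) subr_gt0 => /ltW.
(* For [y != s] the parabola runs strictly inside the inner ball. In units of [rho] this amounts to
   [1 + (m + w) ^+ 2 < 2 * n2], which holds as [|m + w| < 7 / 8] and [n2 >= 15 / 16]. At [y = s] it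
   is on the circle, hence the separate case. *)
have [->|ys] := eqVneq y s; first by rewrite subrr expr0n/= !mulr0 !addr0.
apply: ge_inf => //; rewrite /S/=; apply: cBall; rewrite euclid_norm_lt ?ltW//=.
rewrite c1E c2E.
pose h := y - s; pose w := h / rho.
have hw : h = rho * w by rewrite /w mulrCA divff ?gt_eqF// mulr1.
have w2 : -2^-1 < w < 2^-1.
  by rewrite /w ltr_pdivlMr// ltr_pdivrMr// /h; apply/andP; split; lra.
have wn0 : w != 0.
  by apply/eqP => w00; move/eqP : ys; apply; apply/eqP; rewrite -subr_eq0 -/h hw w00 mulr0.
have w0 : 0 < w ^+ 2 by rewrite exprn_even_gt0.
have m38 : -(3 / 8) <= m <= 3 / 8.
  by rewrite -ler_norml -ler_sqr ?nnegrE// real_normK ?num_real//; nra.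
have mw : (m + w) ^+ 2 < 2 * n2 - 1.
  by move: w2 m38 => /andP[? ?] /andP[? ?]; nra.
have -> : (y - (s + rho * n1)) ^+ 2 +
    (g s + m * (y - s) + rho^-1 * (y - s) ^+ 2 - (g s + rho * n2)) ^+ 2 =
    rho ^+ 2 * (w ^+ 2 * (1 + (m + w) ^+ 2 - 2 * n2) - 2 * w * (n1 + n2 * m) +
      (n1 ^+ 2 + n2 ^+ 2)).
  rewrite -/h.
  have -> : y - (s + rho * n1) = rho * (w - n1) by rewrite opprD addrA -/h hw; ring.
  have -> : rho^-1 * h ^+ 2 = rho * w ^+ 2.
    by rewrite hw exprMn expr2 !mulrA mulVf ?gt_eqF// mul1r.
  by rewrite hw; ring.
rewrite mE n12 subrr mulr0 subr0 -[ltRHS]mulr1 ltr_pM2l ?exprn_gt0//.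
nra.
Qed.
End smooth_boundary.

(** * The singular set *)

Section medial_axis.
Context {R : realType}.
Local Notation enorm := (@euclid_norm R).
Implicit Types (p q Q c e u v : R * R) (A B : set (R * R)).

Lemma closure_euclid_adherent A Q : closure A Q -> euclid_adherent A Q.
Proof.
move=> cQ d d0; have d2 : 0 < d / 2 by rewrite divr_gt0.
have [p [Ap]] := cQ _ (nbhsx_ballx Q _ d2).
rewrite -ball_normE/= distrC ltr_pdivlMr// mulrC => pd; exists p => //.
exact: le_lt_trans (euclid_le_normr _) pd.
Qed.

Lemma C11_boundary_inner_ball A (rho : R) : 0 < rho -> plane_convex A ->
  euclid_open A -> inner_ball_condition A rho -> C11_boundary A.
Proof.
move=> r0 cA oA iA p /closure_euclid_adherent pA pnA.
have NA : ~ A p.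
  by move: pnA; rewrite -(closure_id _).1//; exact/open_closedC/euclid_openP.
have [c pc cB] := iA p pA NA.
(* The unit inner normal at [p] is [(- b, a)]; the rigid motion [inv] sends [p] to the origin and
   this normal to the vertical. *)
pose a := (c.2 - p.2) / rho; pose b := - ((c.1 - p.1) / rho).
have ca : c.2 = p.2 + rho * a by rewrite /a mulrCA divff ?gt_eqF// mulr1 addrC subrK.
have cb : c.1 = p.1 - rho * b.
  by rewrite /b mulrN opprK mulrCA divff ?gt_eqF// mulr1 addrC subrK.
have ab : a ^+ 2 + b ^+ 2 = 1.
  have := sqr_euclid_norm (p - c); rewrite pc /= ca cb => E.
  apply: (mulfI (x := rho ^+ 2)); first by rewrite gt_eqF// exprn_gt0.
  by rewrite mulr1 {2}E; ring.
pose rot v : R * R := (a * v.1 - b * v.2, b * v.1 + a * v.2).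
have rotn v : enorm (rot v) = enorm v.
  apply: euclid_norm_eq; first exact: euclid_norm_ge0.
  rewrite sqr_euclid_norm -[RHS]mul1r -ab /rot/=; ring.
have rotB u v : rot (u - v) = rot u - rot v.
  by rewrite [RHS]surjective_pairing /rot/=; congr pair; ring.
pose inv q : R * R := (a * (q.1 - p.1) + b * (q.2 - p.2), a * (q.2 - p.2) - b * (q.1 - p.1)).
have invK q : p + rot (inv q) = q.
  rewrite [LHS]surjective_pairing [RHS]surjective_pairing /rot /inv/=; congr pair.
    transitivity (p.1 + (a ^+ 2 + b ^+ 2) * (q.1 - p.1)); first by ring.
    by rewrite ab mul1r addrC subrK.
  transitivity (p.2 + (a ^+ 2 + b ^+ 2) * (q.2 - p.2)); first by ring.
  by rewrite ab mul1r addrC subrK.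
pose B : set (R * R) := [set v | A (p + rot v)].
have [||||| g [Cg gB]] := @inner_ball_graph _ B rho r0.
- move=> u v t t01 Au Av; rewrite /B/=.
  rewrite (_ : p + rot _ = t *: (p + rot u) + (1 - t) *: (p + rot v)); first exact: cA.
  rewrite [LHS]surjective_pairing [RHS]surjective_pairing /rot/= /GRing.scale/=.
  by congr pair; ring.
- move=> u Au; have [d d0 dA] := oA _ Au; exists d => // v uv; apply: dA.
  by rewrite opprD addrACA subrr add0r -rotB rotn.
- move=> Q QB NQ; have [d d0| |c' Qc' c'B] := iA (p + rot Q).
  + have [u Au uQ] := QB d d0; exists (p + rot u) => //.
    by rewrite opprD addrACA subrr add0r -rotB rotn.
  + exact: NQ.
  + exists (inv c'); first by
      rewrite -rotn rotB -[RHS]Qc' -[in RHS](invK c') opprD addrACA subrr add0r.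
    move=> q qc'; apply: c'B; rewrite -(invK c') opprD addrACA subrr add0r -rotB.
    by rewrite rotn.
- move=> q qr; apply: cB.
  rewrite (_ : _ - c = rot (q - (0, rho))) ?rotn// [LHS]surjective_pairing /rot/= ca cb.
  by congr pair; ring.
- by rewrite /B/= (_ : p + rot 0 = p)// [LHS]surjective_pairing /rot/= !mulr0 subr0 !addr0 -surjective_pairing.
exists (rho / 4), a, b, g; split => //; first by rewrite divr_gt0.
move=> q qr; rewrite -[in A q](invK q); apply: (gB (inv q)).
by rewrite -rotn (_ : rot _ = q - p)// -[in RHS](invK q) addrC addKr.
Qed.

(** [A] lies in the half-plane tangent at [Q] to the ball around [c]. If the unit normals differed,
    the ball around [p] would cross that line: its point [p + (d * s) *: n], with [s < 1] at least
    the cosine of their angle, is on the wrong side. *)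
Lemma inner_normal_unique A (k d : R) c p Q : plane_convex A -> euclid_open A ->
  0 < k -> 0 < d -> (forall q, enorm (q - c) < k -> A q) ->
  (forall q, enorm (q - p) < d -> A q) -> ~ A Q ->
  enorm (Q - c) = k -> enorm (Q - p) = d -> k^-1 *: (Q - c) = d^-1 *: (Q - p).
Proof.
move=> cA oA k0 d0 cB pB NQ Qc Qp.
pose n := k^-1 *: (Q - c); pose m := d^-1 *: (Q - p).
have nE : Q - c = k *: n by rewrite scalerA divff ?gt_eqF// scale1r.
have mE : Q - p = d *: m by rewrite scalerA divff ?gt_eqF// scale1r.
have n1 : n.1 ^+ 2 + n.2 ^+ 2 = 1.
  by rewrite -sqr_euclid_norm euclid_normZ Qc gtr0_norm ?invr_gt0// mulVf ?expr1n ?gt_eqF.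
have m1 : m.1 ^+ 2 + m.2 ^+ 2 = 1.
  by rewrite -sqr_euclid_norm euclid_normZ Qp gtr0_norm ?invr_gt0// mulVf ?expr1n ?gt_eqF.
rewrite -/n -/m; clearbody n m.
have mn : 1 <= dotp m n.
  rewrite leNgt; apply/negP => mn.
  pose s := Num.max 0 (dotp m n).
  have s0 : 0 <= s by rewrite le_max lexx.
  have smn : dotp m n <= s by rewrite le_max lexx orbT.
  have s1 : s < 1 by rewrite gt_max ltr01.
  have /(tangent_half_plane cA oA k0 cB NQ Qc) : A (p + (d * s) *: n).
    apply: pB; rewrite addrAC subrr add0r euclid_norm_lt ?ltW//=.
    rewrite /GRing.scale/= (_ : _ + _ = d ^+ 2 * s ^+ 2 * (n.1 ^+ 2 + n.2 ^+ 2)); last by ring.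
    rewrite n1 mulr1 -[ltRHS]mulr1 ltr_pM2l ?exprn_gt0//; nra.
  rewrite (_ : dotp _ _ = d * k * (dotp m n - s * (n.1 ^+ 2 + n.2 ^+ 2))).
    by rewrite n1 mulr1 pmulr_rgt0 ?mulr_gt0// subr_gt0 ltNge smn.
  have -> : p + (d * s) *: n - Q = (d * s) *: n - d *: m.
    by rewrite -mE opprB addrA (addrC p).
  have -> : c - Q = - (k *: n) by rewrite -nE opprB.
  by rewrite /dotp/= /GRing.scale/=; ring.
have mn2 : (m.1 - n.1) ^+ 2 + (m.2 - n.2) ^+ 2 = 0.
  apply/eqP; rewrite eq_le addr_ge0 ?sqr_ge0// andbT.
  by move: mn; rewrite /dotp; lra.
move/eqP : mn2; rewrite paddr_eq0 ?sqr_ge0// !sqrf_eq0 !subr_eq0 => /andP[/eqP e1 /eqP e2].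
by rewrite [n]surjective_pairing [m]surjective_pairing e1 e2.
Qed.

Lemma ball_union_inner_ball (f r : R -> R) (rho : R) : 0 < rho ->
  (forall x y, `|f x - f y| <= `|x - y|) -> (forall x y, `|r x - r y| <= `|x - y|) ->
  (forall x, 0 <= x <= 1 -> rho <= r x) ->
  inner_ball_condition (ball_union f r) rho.
Proof.
move=> r0 fL rL rr Q aQ NQ; have [x x01 Qx] := ball_union_touch fL rL aQ NQ.
have rx := rr x x01; have rx0 : 0 < r x by exact: lt_le_trans rx.
(* The ball touching at [Q] is shrunk towards [Q] until its radius is [rho]. *)
pose P : R * R := (x, f x); pose c := Q - (rho / r x) *: (Q - P).
exists c.
  rewrite /c opprB addrC subrK euclid_normZ Qx gtr0_norm ?divr_gt0//.
  by rewrite divfK// gt_eqF.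
move=> q qc; exists x => //; apply: le_lt_trans (euclid_triangle c _ _) _.
rewrite (_ : c - (x, f x) = (1 - rho / r x) *: (Q - P)); last first.
  by rewrite scalerBl scale1r /c addrAC.
rewrite euclid_normZ Qx ger0_norm; last by rewrite subr_ge0 ler_pdivrMr// mul1r.
by rewrite mulrBl mul1r divfK ?gt_eqF//; lra.
Qed.

Lemma Sigma_ball_union (f r : R -> R) : plane_convex (ball_union f r) ->
  (forall x y, `|f x - f y| <= `|x - y|) -> (forall x y, `|r x - r y| <= `|x - y|) ->
  (forall x, 0 <= x <= 1 -> 0 < r x) ->
  (forall x, 0 <= x <= 1 -> exists e e', [/\ enorm e = 1, enorm e' = 1, e != e',
    ~ ball_union f r ((x, f x) + r x *: e) &
    ~ ball_union f r ((x, f x) + r x *: e')]) ->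
  Sigma (~` ball_union f r) = [set (x, f x) | x in `[0, 1]].
Proof.
move=> cA fL rL r0 contact; have oA := @ball_union_open R f r.
set A := ball_union f r in cA oA contact *.
have rB x : 0 <= x <= 1 -> forall q, enorm (q - (x, f x)) < r x -> A q.
  by move=> x01 q qx; exists x.
apply/seteqP; split=> [p [/contrapT Ap nd]|_ [x + <-]]; last first.
  rewrite /= in_itv/= => x01; have [e [e' [e1 e1' ee' Ne Ne']]] := contact x x01.
  split; last exact: (two_nearest_not_differentiable (rB x x01) (r0 x x01) e1 e1' ee').
  apply; apply: (rB x x01).
  by rewrite subrr (@euclid_norm_eq _ 0 0)//= ?r0// expr0n/= addr0.
have clN : closed (~` A) by exact/open_closedC/euclid_openP.
have neN : ~` A !=set0.
  have [|e [_ [_ _ _ Ne _]]] := contact 0; first by rewrite lexx ler01.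
  by exists ((0, f 0) + r 0 *: e).
have [Q NQ Qp] := euclid_dist_attained p clN neN.
set d := euclid_dist _ p in Qp.
have pB q : enorm (q - p) < d -> A q.
  by move=> qd; apply: contrapT => Nq; have := @euclid_dist_le _ (~` A) p q Nq; rewrite leNgt qd.
have d0 : 0 < d.
  have [s s0 sA] := oA _ Ap; apply: (lt_le_trans s0).
  by rewrite -Qp leNgt; apply/negP => /sA.
have aQ : euclid_adherent A Q.
  move=> s s0; pose t := Num.min 1 (s / (2 * d)).
  have t0 : 0 < t by rewrite lt_min ltr01 divr_gt0// mulr_gt0.
  have t1 : t <= 1 by rewrite ge_min lexx.
  have ts : t <= s / (2 * d) by rewrite ge_min lexx orbT.
  exists (Q - t *: (Q - p)).
    apply: pB; rewrite addrAC -[X in X - _]scale1r -scalerBl euclid_normZ Qp.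
    by rewrite ger0_norm ?subr_ge0//; nra.
  rewrite addrAC subrr add0r euclid_normN euclid_normZ Qp gtr0_norm//.
  by move: ts; rewrite ler_pdivlMr ?mulr_gt0//; lra.
have [x x01 Qx] := ball_union_touch fL rL aQ NQ.
have rx0 := r0 x x01.
have := inner_normal_unique cA oA rx0 d0 (rB x x01) pB NQ Qx Qp.
set e := (r x)^-1 *: _ => eE.
have e1 : enorm e = 1.
  by rewrite euclid_normZ Qx gtr0_norm ?invr_gt0// mulVf// gt_eqF.
have QE : Q = (x, f x) + r x *: e.
  by rewrite scalerA divff ?gt_eqF// scale1r addrC subrK.
have pE : p = (x, f x) + (r x - d) *: e.
  rewrite scalerBl addrA -QE eE scalerA divff ?gt_eqF// scale1r.
  by rewrite opprB addrC subrK.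
(* The three cases put [p] strictly between the centre and [Q], beyond the centre, or at the
   centre. *)
clearbody e; have [dr|rd|dr] := ltgtP d (r x).
- exfalso; apply: nd; rewrite pE.
  apply: (differentiable_on_normal (rB x x01) e1); last by rewrite -QE.
  by apply/andP; split; lra.
- have [e' [e1' ee' Ne']] : exists e', [/\ enorm e' = 1, e' != e &
      ~ A ((x, f x) + r x *: e')].
    have [u [v [u1 v1 uv Nu Nv]]] := contact x x01.
    have [ue|] := eqVneq u e; last by exists u.
    by exists v; split=> //; rewrite -ue eq_sym.
  exfalso; apply/Ne'/pB; rewrite pE.
  rewrite (_ : _ - _ = r x *: e' + (d - r x) *: e); last first.
    by rewrite opprD addrACA subrr add0r -scaleNr opprB.
  have E1 : e.1 ^+ 2 + e.2 ^+ 2 = 1 by rewrite -sqr_euclid_norm e1 expr1n.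
  have E2 : e'.1 ^+ 2 + e'.2 ^+ 2 = 1 by rewrite -sqr_euclid_norm e1' expr1n.
  have lt1 : dotp e' e < 1.
    have : 0 < (e'.1 - e.1) ^+ 2 + (e'.2 - e.2) ^+ 2.
      rewrite lt_neqAle addr_ge0 ?sqr_ge0// andbT eq_sym paddr_eq0 ?sqr_ge0//.
      rewrite !sqrf_eq0 !subr_eq0; apply: contra ee' => /andP[/eqP h1 /eqP h2].
      by rewrite [e]surjective_pairing [e']surjective_pairing h1 h2.
    by rewrite /dotp; lra.
  rewrite euclid_norm_lt ?ltW//= /GRing.scale/=.
  rewrite (_ : _ + _ = r x ^+ 2 * (e'.1 ^+ 2 + e'.2 ^+ 2) +
     2 * (r x * (d - r x)) * dotp e' e + (d - r x) ^+ 2 * (e.1 ^+ 2 + e.2 ^+ 2)); last first.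
    by rewrite /dotp; ring.
  have : r x * (d - r x) * dotp e' e < r x * (d - r x).
    by rewrite gtr_pMr ?mulr_gt0// subr_gt0.
  by rewrite E1 E2; lra.
- by exists x; rewrite ?in_itv// pE dr subrr scale0r addr0.
Qed.

End medial_axis.

(** * The domain *)

Lemma supporting_lines_convex (R : realType) (h : R -> R) :
  (forall x, exists s, forall y, h x + s * (y - x) <= h y) ->
  forall x y t, 0 <= t <= 1 -> h (t * x + (1 - t) * y) <= t * h x + (1 - t) * h y.
Proof.
move=> H x y t /andP[t0 t1]; have [s Hs] := H (t * x + (1 - t) * y).
move: Hs; set z := t * x + _ => Hs.
have hx : t * (h z + s * (x - z)) <= t * h x by rewrite ler_wpM2l.
have hy : (1 - t) * (h z + s * (y - z)) <= (1 - t) * h y by rewrite ler_wpM2l ?subr_ge0.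
apply: le_trans (lerD hx hy); rewrite le_eqVlt; apply/orP; left; apply/eqP.
by rewrite /z; ring.
Qed.

Lemma supporting_lines_lipschitz (R : realType) (h : R -> R) (k : R) :
  (forall x, exists2 s, `|s| <= k & forall y, h x + s * (y - x) <= h y) ->
  forall x y, `|h x - h y| <= k * `|x - y|.
Proof.
move=> H.
have aux x y : h x - h y <= k * `|x - y|.
  have [s sk Hs] := H x; apply: (@le_trans _ _ (s * (x - y))).
    by have := Hs y; lra.
  by apply: le_trans (ler_norm _) _; rewrite normrM ler_wpM2r.
move=> x y; rewrite ler_norml aux andbT lerNl opprB distrC; exact: aux.
Qed.

Lemma convex_functionP (R : realType) (I : set R) (h : R -> R) :
  (forall x y t, 0 <= t <= 1 -> h (t * x + (1 - t) * y) <= t * h x + (1 - t) * h y) ->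
  convex_function (I : set (convex_lmodType R^o)) h.
Proof.
move=> H k x y _ _; rewrite conv_realE conv_regularE; apply: H.
by apply/andP; split.
Qed.

Unset Implicit Arguments.
Set Strict Implicit.

Theorem proposition2p10 (R : realType) (eps : R) (eps01 : 0 < eps < 1) :
  exists Omega : set (R * R),
    [/\ bounded_set Omega, open Omega, C11_boundary Omega &
    exists f : R -> R,
      [/\ Sigma (~` Omega) = [set (x, f x) | x in `[0, 1]],
          DC_on `[0, 1] f &
      exists C : set R,
        [/\ closed C, C `<=` `[0, 1],
            ((1 - eps)%:E <= lebesgue_measure C)%E &
        forall x delta : R, C x -> 0 < delta ->
          let I := `]x - delta, x + delta[ `&` `[0, 1] in
          [/\ infinite_set (upward_jumps I f),
              infinite_set (downward_jumps I f),
              ~ C1_on I f,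
              ~ locally_semiconcave_on I f &
              ~ locally_semiconvex_on I f]]]].
Proof.
have [f [G [sub Gx dense up down]]] := jump_profile R.
(* Convexity of [G + f] and [G - f] becomes concavity of [r - f] and [r + f]. *)
pose r x := 1 - G x.
have supp x : exists2 s, `|s| <= 2^-1 & forall y, G x + f x + s * (y - x) <= G y + f y.
  have [a [b [a4 b4 H _]]] := sub x; exists (b + a) => //.
  by apply: le_trans (ler_normD _ _) _; lra.
have supm x : exists2 s, `|s| <= 2^-1 & forall y, G x - f x + s * (y - x) <= G y - f y.
  have [a [b [a4 b4 _ H]]] := sub x; exists (b - a) => //.
  by apply: le_trans (ler_normB _ _) _; lra.
have cvxp := @supporting_lines_convex _ (fun x => G x + f x)
  (fun x => let: ex_intro2 s _ h := supp x in ex_intro _ s h).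
have cvxm := @supporting_lines_convex _ (fun x => G x - f x)
  (fun x => let: ex_intro2 s _ h := supm x in ex_intro _ s h).
have lipp := @supporting_lines_lipschitz _ (fun x => G x + f x) _ supp.
have lipm := @supporting_lines_lipschitz _ (fun x => G x - f x) _ supm.
have fL x y : `|f x - f y| <= `|x - y|.
  have := lipp x y; have := lipm x y; rewrite !ler_norml => /andP[? ?] /andP[? ?].
  by have := normr_ge0 (x - y) => ?; apply/andP; split; lra.
have rL x y : `|r x - r y| <= `|x - y|.
  have := lipp x y; have := lipm x y; rewrite /r !ler_norml => /andP[? ?] /andP[? ?].
  by have := normr_ge0 (x - y) => ?; apply/andP; split; lra.
have rB x : 0 <= x <= 1 -> 3 / 4 <= r x <= 5 / 4.
  move=> /andP[x0 x1]; have := Gx x; rewrite (ger0_norm x0) ler_norml /r => /andP[? ?].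
  by apply/andP; split; lra.
have cA : plane_convex (ball_union f r).
  apply: ball_union_convex => x y t _ _ t01 /=; set z := t * x + _.
  have := cvxp x y t t01; have := cvxm x y t t01; rewrite -/z => hm hp.
  rewrite addrC -lerBrDr ler_norml /r; apply/andP; split; lra.
exists (ball_union f r); split.
- exists (5 / 4 + 2 * (2 + `|f 0|)); split; first exact: num_real.
  move=> M HM p [x x01 px]; apply: ltW; apply: le_lt_trans HM.
  apply: le_trans (normr_le_euclid _) _.
  rewrite -(subrK (x, f x) p); apply: le_trans (euclid_normD _ _) _.
  apply: lerD; first by apply: le_trans (ltW px) _; have /andP[] := rB x x01.
  apply: le_trans (euclid_le_normr _) _; rewrite ler_wpM2l//.
  have /andP[x0 x1] := x01; have f0 := normr_ge0 (f 0).
  have -> : `|(x, f x)| = Num.max `|x| `|f x| by [].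
  rewrite ge_max (ger0_norm x0); apply/andP; split; first by lra.
  rewrite -(subrK (f 0) (f x)); apply: le_trans (ler_normD _ _) _; rewrite lerD2r.
  by apply: le_trans (fL _ _) _; rewrite subr0 ger0_norm//; lra.
- exact/euclid_openP/ball_union_open.
- apply: (@C11_boundary_inner_ball _ _ (3 / 4)); first by lra.
  + exact: cA.
  + exact: ball_union_open.
  + by apply: ball_union_inner_ball => // x /rB/andP[].
exists f; split.
- apply: Sigma_ball_union => //; first by move=> x /rB/andP[rx _]; apply: lt_le_trans rx; lra.
  move=> x x01; have [a [b [a4 b4 Hp Hm]]] := sub x.
  have b1 : `|b| < 1 by lra.
  have [s [t [st Es Et]]] := two_unit_normals a b1.
  have unit_norm u : (b - u * a) ^+ 2 + u ^+ 2 = 1 -> euclid_norm (b - u * a, u) = 1.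
    by move=> h; apply: euclid_norm_eq => //; rewrite /= h expr1n.
  have cont u : (b - u * a) ^+ 2 + u ^+ 2 = 1 ->
      ~ ball_union f r ((x, f x) + r x *: (b - u * a, u)).
    move=> h; apply: ball_union_contact => //.
    + rewrite -ler_sqr ?nnegrE// real_normK ?num_real// expr1n -h lerDr sqr_ge0//.
    + by move=> y; have := Hm y; rewrite /r; lra.
    + by move=> y; have := Hp y; rewrite /r; lra.
  exists (b - s * a, s), (b - t * a, t); split; [exact: unit_norm..| |exact: cont|exact: cont].
  by apply: contra st => /eqP[_ ->].
(* [f] is half the difference of the convex functions [G + f] and [G - f]. *)
- exists (fun x => 2^-1 * (G x + f x)), (fun x => 2^-1 * (G x - f x)); split.
  + by apply: convex_functionP => x y t t01; have := cvxp x y t t01; lra.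
  + by apply: convex_functionP => x y t t01; have := cvxm x y t t01; lra.
  + by move=> x _; lra.
exists `[0, 1]%classic; split => //.
- exact: itv_closed.
- rewrite lebesgue_measure_itv/= lte_fin ltr01 -EFinB lee_fin subr0.
  by have /andP[? _] := eps01; lra.
move=> x delta; rewrite /= in_itv/= => /andP[x0 x1] d0.
set I := `]x - delta, x + delta[ `&` _.
(* The open interval from [a] to [b] is contained in the interior of [I], and is nonempty also when
   [x] is [0] or [1]; corners of both directions are dense in it. *)
pose a := Num.max (x - delta) 0; pose b := Num.min (x + delta) 1.
have ab : a < b by rewrite lt_min !gt_max; apply/andP; split; apply/andP; split; lra.
have intI t : a < t < b -> I° t.
  rewrite gt_max lt_min => /andP[/andP[t1 t2] /andP[t3 t4]].
  exists (Num.min (Num.min (t - (x - delta)) t) (Num.min (x + delta - t) (1 - t))).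
    by rewrite /= !lt_min; apply/andP; split; apply/andP; split; lra.
  move=> y /=; rewrite !lt_min !ltr_norml.
  move=> /andP[/andP[/andP[? ?] /andP[? ?]] /andP[/andP[? ?] /andP[? ?]]].
  by split; rewrite /= in_itv/=; apply/andP; split; lra.
have [t [l [k [tab tl tr lk]]]] := up a b ab.
have [t' [l' [k' [tab' tl' tr' lk']]]] := down a b ab.
split.
- apply: (infinite_dense ab) => u v au uv vb.
  have [s [m [n [/andP[su sv] sm sn mn]]]] := up u v uv.
  exists s; first by rewrite su sv.
  split; first by apply: intI; apply/andP; split; lra.
  exists m, n; split; [exact: strict_deriv_lim_left|exact: strict_deriv_lim_right|].
  by rewrite subr_gt0.
- apply: (infinite_dense ab) => u v au uv vb.
  have [s [m [n [/andP[su sv] sm sn mn]]]] := down u v uv.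
  exists s; first by rewrite su sv.
  split; first by apply: intI; apply/andP; split; lra.
  exists m, n; split; [exact: strict_deriv_lim_left|exact: strict_deriv_lim_right|].
  by rewrite subr_lt0.
- exact: (corner_not_C1 (intI t tab) tl tr lk).
- exact: (corner_not_semiconcave (intI t tab) tl tr lk).
(* A downward corner of [f] is an upward corner of [- f]. *)
- apply: (corner_not_semiconcave (intI t' tab') (strict_derivN tl') (strict_derivN tr')).
  by rewrite ltrN2.
Qed.
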